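(* Let $k,k'>1$ be dual indices, i.e. $k^{-1}+k'^{-1}=1$, and let $(M,\Omega,\mathbf{p})$ be a $k'$-integrable parametrized measure model. If $\varphi\in L^k_M(\Omega)$ is ($k$-)regular, then the map $$M\to\mathbb{R},\qquad \xi\mapsto\mathbb{E}_{\mathbf{p}(\xi)}(\varphi)=\int_\Omega\varphi\,d\mathbf{p}(\xi)$$ is Gâteaux-differentiable, and for $\xi\in M$ and $X\in T_\xi M$ its Gâteaux-derivative is $$\partial_X\mathbb{E}_{\mathbf{p}(\xi)}(\varphi)=\mathbb{E}_{\mathbf{p}(\xi)}(\varphi\;\partial_X\log\mathbf{p}(\xi))=\int_\Omega\varphi\;\partial_X\log\mathbf{p}(\xi)\,d\mathbf{p}(\xi).$$
   Context: $\Omega$ is a measurable space. $\mathcal{S}(\Omega)$ is the Banach space of finite signed measures on $\Omega$ with the total variation norm, and $\mathcal{M}(\Omega)\subset\mathcal{S}(\Omega)$ is the set of finite (nonnegative) measures. A parametrized measure model is a triple $(M,\Omega,\mathbf{p})$ where $M$ is a (finite or infinite dimensional) Banach manifold and $\mathbf{p}:M\to\mathcal{M}(\Omega)\subset\mathcal{S}(\Omega)$ is a Fréchet-$C^1$ map. Logarithmic derivative: for $v\in T_\xi M$ the signed measure $d_\xi\mathbf{p}(v)$ is absolutely continuous with respect to $\mathbf{p}(\xi)$ (known fact), and $\partial_v\log\mathbf{p}(\xi):=\frac{d\{d_\xi\mathbf{p}(v)\}}{d\mathbf{p}(\xi)}\in L^1(\Omega,\mathbf{p}(\xi))$. Powers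 of measures: for $r\in(0,1]$, $\mathcal{S}^r(\Omega)$ is the directed limit of the spaces $L^{1/r}(\Omega,\mu)$ over $\mu\in\mathcal{M}(\Omega)$, ordered by domination, along the isometric inclusions $L^{1/r}(\Omega,\mu_1)\to L^{1/r}(\Omega,\mu_2)$, $\phi\mapsto\phi\,(d\mu_1/d\mu_2)^r$ (for $\mu_2$ dominating $\mu_1$). The element represented by $\phi\in L^{1/r}(\Omega,\mu)$ is written $\phi\,\mu^r$, and $\|\phi\,\mu^r\|_{\mathcal{S}^r(\Omega)}=\|\phi\|_{L^{1/r}(\Omega,\mu)}$. The model is called $l$-integrable ($l\geq1$) if the map $\mathbf{p}^{1/l}:M\to\mathcal{S}^{1/l}(\Omega)$, $\xi\mapsto\mathbf{p}(\xi)^{1/l}$, is Fréchet-$C^1$. $L^k_M(\Omega)$ is the set of functions $\varphi:\Omega\to\mathbb{R}$ with $\varphi\in L^k(\Omega,\mathbf{p}(\xi))$ for all $\xi\in M$. A function $\varphi$ on $\Omega$ is called $k$-regular (or simply regular) if $\varphi\in L^k_M(\Omega)$ and $\xi\mapsto\|\varphi\|_{L^k(\Omega,\mathbf{p}(\xi))}$ is locally bounded, i.e. $\limsup_{\xi\to\xi_0}\|\varphi\|_{L^k(\Omega,\mathbf{p}(\xi))}<\infty$ for all $\xi_0\in M$. *)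

(* Defs.v *)
From HB Require Import structures.
From mathcomp Require Import all_boot all_order all_algebra generic_quotient.
From mathcomp Require Import all_classical all_reals all_analysis.
From mathcomp Require Import measurable_realfun.
Import Order.TTheory GRing.Theory Num.Theory.
Import numFieldNormedType.Exports.

Set Implicit Arguments.
Unset Strict Implicit.
Unset Printing Implicit Defensive.

Local Open Scope classical_set_scope.
Local Open Scope ring_scope.

Section frechet.
Context {R : realType} {V W : normedModType R}.

(* The second condition is the continuity of x |-> 'd f x for the operator
   norm. *)
Definition C1_on (U : set V) (f : V -> W) : Prop := forall a, U a ->
  differentiable f a /\
  forall e : R, 0 < e -> \forall x \near a, forall v : V,
    `|'d f x v - 'd f a v| <= e * `|v|.

(* A Gateaux derivative is, by convention, a bounded linear operator. *)
Definition gateaux_derivative_at (f : V -> W) (a : V) (L : V -> W) : Prop :=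
  [/\ linear L, continuous L & forall v : V, is_derive a v f (L v)].

End frechet.

(* A Banach manifold, given by an atlas of charts [bm_coord i], each defined on
   the open set [bm_dom i] and with values in its own Banach space
   [bm_model i]; [bm_param i] is the inverse of [bm_coord i] (outside
   [bm_dom i] and its image, both are arbitrary).  Transition maps are only
   required to be C^1, so that C^k (k >= 1) and smooth atlases are covered;
   neither separation nor a common model space is assumed. *)
Record banachManifold (R : realType) := BanachManifold {
  bm_space :> topologicalType ;
  bm_chart : Type ;
  bm_model : bm_chart -> completeNormedModType R ;
  bm_dom : bm_chart -> set bm_space ;
  bm_coord : forall i, bm_space -> bm_model i ;
  bm_param : forall i, bm_model i -> bm_space ;
  bm_dom_open : forall i, open (bm_dom i) ;
  bm_img_open : forall i, open (bm_coord i @` bm_dom i) ;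
  bm_coordK : forall i x, bm_dom i x -> bm_param (bm_coord i x) = x ;
  bm_coord_cont : forall i x, bm_dom i x -> {for x, continuous (bm_coord i)} ;
  bm_param_cont : forall i x, bm_dom i x ->
    {for bm_coord i x, continuous (@bm_param i)} ;
  bm_cover : forall x, exists i, bm_dom i x ;
  bm_transition : forall i j,
    C1_on (bm_coord i @` (bm_dom i `&` bm_dom j)) (bm_coord j \o @bm_param i)
}.
Arguments bm_coord {R b} i.
Arguments bm_param {R b} i.

Section tangent.
Context {R : realType} (M : banachManifold R).
Implicit Types (x : M) (i j : bm_chart M).

(* A tangent vector at x, i.e. a class of triples (chart at x, vector of the
   model space) modulo the differentials of the transition maps, is encoded as
   the function giving its representative in every chart at x. *)
Record tangent x := Tangent {
  tan_rep :> forall i, bm_dom i x -> bm_model i ;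
  tan_compat : forall i j (hi : bm_dom i x) (hj : bm_dom j x),
    tan_rep hj = 'd (bm_coord j \o bm_param i) (bm_coord i x) (tan_rep hi)
}.

Definition chart_at x : {i | bm_dom i x} := cid (bm_cover x).

Context {V : normedModType R}.

Definition C1_map (f : M -> V) : Prop :=
  forall i, C1_on (bm_coord i @` bm_dom i) (f \o bm_param i).

Definition diff_along (f : M -> V) x (X : tangent x) : V :=
  'd (f \o bm_param (sval (chart_at x))) (bm_coord (sval (chart_at x)) x)
    (X _ (svalP (chart_at x))).

Lemma diff_alongE (f : M -> V) x (X : tangent x) i (hi : bm_dom i x) :
  C1_map f -> diff_along f X = 'd (f \o bm_param i) (bm_coord i x) (X _ hi).
Proof.
rewrite /diff_along; move: (svalP (chart_at x)) => /=.
move: (sval (chart_at x)) => j hj Cf.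
have fj : differentiable (f \o bm_param j) (bm_coord j x).
  by have [|//] := @Cf j (bm_coord j x); exists x.
have fi : differentiable (f \o bm_param i) (bm_coord i x).
  by have [|//] := @Cf i (bm_coord i x); exists x.
have tij : differentiable (bm_coord j \o bm_param i) (bm_coord i x).
  by have [|//] := @bm_transition _ M i j (bm_coord i x); exists x.
have tx : bm_coord j x = (bm_coord j \o bm_param i) (bm_coord i x).
  by rewrite /= bm_coordK.
rewrite (tan_compat X hi hj); move: (X i hi) => v.
move: fj; rewrite tx => fj.
apply: etrans (esym (congr1 (@^~ v) (diff_comp tij fj))) _.
apply: etrans (esym (deriveE v (differentiable_comp tij fj))) _.
apply: etrans _ (deriveE v fi).
apply: near_eq_derive.
have dj : nbhs (bm_param i (bm_coord i x)) (bm_dom j).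
  by rewrite bm_coordK//; apply: open_nbhs_nbhs; split => //; exact: bm_dom_open.
have /= := @bm_param_cont _ M i x hi _ dj.
rewrite -[X in X -> _]nbhs_nearE; apply: filterS => y /= jy.
by rewrite bm_coordK.
Qed.

(* Gateaux differentiability is not invariant under nonlinear changes of
   coordinates: it is required here in every chart at x. *)
Definition is_gateaux_derivative (f : M -> V) x (D : tangent x -> V) : Prop :=
  forall i (hi : bm_dom i x), exists2 L : bm_model i -> V,
    gateaux_derivative_at (f \o bm_param i) (bm_coord i x) L &
    forall X : tangent x, D X = L (X _ hi).

End tangent.

Section signed_measure.
Context {d : measure_display} (T : measurableType d) (R : realType).

(* A charge is a total function on [set T]; the finite signed measures are the
   charges modulo their (irrelevant) values on nonmeasurable sets, which are
   normalized to 0. *)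
Record signed_measure := SignedMeasure {
  sm_charge :> {charge set T -> \bar R} ;
  sm_out : forall A, ~ measurable A -> sm_charge A = 0%E
}.
Implicit Types nu : signed_measure.

HB.instance Definition _ := gen_eqMixin signed_measure.
HB.instance Definition _ := gen_choiceMixin signed_measure.

Lemma sm_eq nu1 nu2 :
  (forall A, measurable A -> nu1 A = nu2 A) -> nu1 = nu2.
Proof.
move=> nuE; have {nuE} : sm_charge nu1 = sm_charge nu2 :> (set T -> \bar R).
  apply/funext => A; have [/nuE //|nA] := pselect (measurable A).
  by rewrite !sm_out.
case: nu1 nu2 => [[f [[f1] [f2] [f3]]] fout] [[g [[g1] [g2] [g3]]] gout] /= fg.
case: _ / fg in g1 g2 g3 gout *.
rewrite (Prop_irrelevance f1 g1) (Prop_irrelevance f2 g2).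
rewrite (Prop_irrelevance f3 g3) in fout *.
by congr SignedMeasure; exact: Prop_irrelevance.
Qed.

Definition sm_of_charge (nu : {charge set T -> \bar R}) : signed_measure.
Proof.
exists (crestr0 nu measurableT) => A nA.
by rewrite /= /crestr0 memNset.
Defined.

Lemma sm_of_chargeE (nu : {charge set T -> \bar R}) A :
  measurable A -> sm_of_charge nu A = nu A.
Proof. by move=> mA; rewrite /= /crestr0 mem_set// /crestr setIT. Qed.

Definition sm_of_measure (mu : {finite_measure set T -> \bar R}) :
  signed_measure := sm_of_charge (charge_of_finite_measure mu).

Definition sm_zero := sm_of_charge czero.
Definition sm_opp nu := sm_of_charge (copp nu).
Definition sm_add nu1 nu2 := sm_of_charge (cadd nu1 nu2).
Definition sm_scale (c : R) nu := sm_of_charge (cscale c nu).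

Let zeroE A : measurable A -> sm_zero A = 0%E.
Proof. exact: sm_of_chargeE. Qed.

Let oppE nu A : measurable A -> sm_opp nu A = (- nu A)%E.
Proof. exact: sm_of_chargeE. Qed.

Let addE nu1 nu2 A : measurable A -> sm_add nu1 nu2 A = (nu1 A + nu2 A)%E.
Proof. exact: sm_of_chargeE. Qed.

Let scaleE c nu A : measurable A -> sm_scale c nu A = (c%:E * nu A)%E.
Proof. exact: sm_of_chargeE. Qed.

Lemma sm_addA : associative sm_add.
Proof. by move=> x y z; apply: sm_eq => A mA; rewrite !addE// addeA. Qed.

Lemma sm_addC : commutative sm_add.
Proof. by move=> x y; apply: sm_eq => A mA; rewrite !addE// addeC. Qed.

Lemma sm_add0 : left_id sm_zero sm_add.
Proof. by move=> x; apply: sm_eq => A mA; rewrite addE// zeroE// add0e. Qed.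

Lemma sm_addN : left_inverse sm_zero sm_opp sm_add.
Proof.
move=> x; apply: sm_eq => A mA; rewrite addE// oppE// zeroE//.
by rewrite addeC subee// fin_num_measure.
Qed.

HB.instance Definition _ :=
  GRing.isZmodule.Build signed_measure sm_addA sm_addC sm_add0 sm_addN.

Lemma sm_scaleA a b nu : sm_scale a (sm_scale b nu) = sm_scale (a * b) nu.
Proof. by apply: sm_eq => A mA; rewrite !scaleE// muleA EFinM. Qed.

Lemma sm_scale1 : left_id 1 sm_scale.
Proof. by move=> nu; apply: sm_eq => A mA; rewrite scaleE// mul1e. Qed.

Lemma sm_scaleDr : right_distributive sm_scale +%R.
Proof.
move=> a x y; apply: sm_eq => A mA; rewrite scaleE// !addE// !scaleE//.
by rewrite muleDr// fin_num_adde_defl// fin_num_measure.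
Qed.

Lemma sm_scaleDl nu : {morph sm_scale^~ nu : a b / a + b}.
Proof.
move=> a b; apply: sm_eq => A mA; rewrite addE// !scaleE//.
by rewrite EFinD muleDl// fin_num_measure.
Qed.

HB.instance Definition _ := GRing.Zmodule_isLmodule.Build R signed_measure
  sm_scaleA sm_scale1 sm_scaleDr sm_scaleDl.

Lemma sm_addE nu1 nu2 A : measurable A -> (nu1 + nu2) A = (nu1 A + nu2 A)%E.
Proof. exact: sm_of_chargeE. Qed.

Lemma sm_scaleE c nu A : measurable A -> (c *: nu) A = (c%:E * nu A)%E.
Proof. exact: sm_of_chargeE. Qed.

Definition hahn_pos nu : set T := sval (cid (Hahn_decomposition nu)).

Definition hahn_neg nu : set T :=
  sval (cid (svalP (cid (Hahn_decomposition nu)))).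

Lemma hahn_posneg nu : hahn_decomposition nu (hahn_pos nu) (hahn_neg nu).
Proof. exact: (svalP (cid (svalP (cid (Hahn_decomposition nu))))). Qed.

Definition tv_norm nu : R := fine (charge_variation (hahn_posneg nu) setT).

Lemma tv_normE nu :
  (tv_norm nu)%:E = (`|nu (hahn_pos nu)| + `|nu (hahn_neg nu)|)%E.
Proof.
have [[mP P0] [mN N0] _ _] := hahn_posneg nu.
rewrite fineK ?fin_num_measure// /charge_variation.
rewrite jordan_posE cjordan_posE jordan_negE cjordan_negE.
rewrite /crestr0 mem_set// /crestr !setTI gee0_abs ?P0// lee0_abs ?N0//.
Qed.

Lemma le_tv_norm nu P N : measurable P -> measurable N -> P `&` N = set0 ->
  (`|nu P| + `|nu N| <= (tv_norm nu)%:E)%E.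
Proof.
move=> mP mN PN0; rewrite fineK ?fin_num_measure//.
apply: (@le_trans _ _ (charge_variation (hahn_posneg nu) P +
   charge_variation (hahn_posneg nu) N)%E).
  by apply: leeD; exact: abse_charge_variation.
rewrite -measureU//; apply: le_measure; rewrite ?inE//; exact: measurableU.
Qed.

Lemma tv_normD nu1 nu2 : tv_norm (nu1 + nu2) <= tv_norm nu1 + tv_norm nu2.
Proof.
have [[mP _] [mN _] _ PN0] := hahn_posneg (nu1 + nu2).
rewrite -lee_fin EFinD tv_normE !sm_addE//.
apply: le_trans (leeD (le_tv_norm nu1 mP mN PN0) (le_tv_norm nu2 mP mN PN0)).
by rewrite addeACA; apply: leeD; exact: lee_abs_add.
Qed.

Let tv_normZ_le c nu : tv_norm (c *: nu) <= `|c| * tv_norm nu.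
Proof.
have [[mP _] [mN _] _ PN0] := hahn_posneg (c *: nu).
rewrite -lee_fin EFinM tv_normE !sm_scaleE// !abseM -ge0_muleDr//.
by apply: lee_wpmul2l; [rewrite lee_fin|exact: le_tv_norm].
Qed.

Lemma tv_normZ c nu : tv_norm (c *: nu) = `|c| * tv_norm nu.
Proof.
apply/eqP; rewrite eq_le tv_normZ_le/=.
have [->|c0] := eqVneq c 0.
  by rewrite normr0 mul0r -lee_fin tv_normE adde_ge0.
rewrite -ler_pdivlMl ?normr_gt0// -normfV.
by rewrite -[in leLHS](scalerK c0 nu) tv_normZ_le.
Qed.

Lemma tv_norm0_eq0 nu : tv_norm nu = 0 -> nu = 0.
Proof.
move=> nu0; apply: sm_eq => A mA; rewrite [RHS]sm_of_chargeE//.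
have := le_tv_norm nu mA measurable0 (setI0 A).
rewrite nu0 charge0 abse0 adde0 => A0; apply/eqP.
by rewrite -abse_eq0 eq_le A0 abse_ge0.
Qed.

HB.instance Definition _ := Lmodule_isNormed.Build R signed_measure
  tv_normD tv_normZ tv_norm0_eq0.

End signed_measure.
Arguments sm_of_measure {d T R} mu.

Section transition.
Context {d : measure_display} {T : measurableType d} {R : realType} (r : R).
Implicit Types (mu nu la : {finite_measure set T -> \bar R}) (f g : T -> R).
Local Open Scope charge_scope.

Definition rn_density nu mu (x : T) : R :=
  fine (('d (charge_of_finite_measure nu) '/d mu) x).

(* The inclusion L^(1/r)(nu) -> L^(1/r)(mu), f |-> f (d nu / d mu)^r. *)
Definition pow_incl nu mu f : T -> R := fun x => f x * rn_density nu mu x `^ r.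

Lemma rn_densityE nu mu : nu `<< mu ->
  EFin \o rn_density nu mu = 'd (charge_of_finite_measure nu) '/d mu.
Proof.
by move=> numu; apply/funext => x /=; rewrite fineK// Radon_Nikodym_fin_num.
Qed.

Lemma rn_density_measurable nu mu :
  nu `<< mu -> measurable_fun [set: T] (rn_density nu mu).
Proof.
by move=> numu; apply/measurable_EFinP; rewrite rn_densityE.
Qed.

Lemma rn_density_ae nu mu : nu `<< mu ->
  ae_eq mu setT (Radon_Nikodym_SigmaFinite.f nu mu) (EFin \o rn_density nu mu).
Proof.
by move=> numu; rewrite rn_densityE//; exact: ae_eq_Radon_Nikodym_SigmaFinite.
Qed.

Lemma rn_density_ge0 nu mu : nu `<< mu ->
  \forall x \ae mu, 0 <= rn_density nu mu x.
Proof.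
move=> numu; apply: filterS (rn_density_ae numu) => x /(_ I) /= h.
by rewrite -lee_fin -h Radon_Nikodym_SigmaFinite.f_ge0.
Qed.

Lemma rn_density_chain nu mu la : nu `<< mu -> mu `<< la ->
  \forall x \ae la, rn_density nu la x = rn_density nu mu x * rn_density mu la x.
Proof.
move=> numu mula.
have nula : nu `<< la by exact: null_dominates_trans numu mula.
have := @Radon_Nikodym_chain_rule _ _ _ (charge_of_finite_measure nu) la mu numu mula.
apply: filterS => x /(_ I) /= h; rewrite {1}/rn_density h fineM//.
- exact: Radon_Nikodym_fin_num.
- exact: Radon_Nikodym_fin_num.
Qed.

Lemma ge0_integral_rn_density nu mu (F : T -> \bar R) : nu `<< mu ->
    measurable_fun setT F -> (forall x, 0 <= F x)%E ->
  (\int[mu]_x (F x * (rn_density nu mu x)%:E) = \int[nu]_x F x)%E.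
Proof.
move=> numu mF F0.
rewrite -(Radon_Nikodym_SigmaFinite.change_of_variables numu)//.
apply: ae_eq_integral => //.
- apply: emeasurable_funM => //; apply: measurableT_comp => //.
  exact: rn_density_measurable.
- apply: emeasurable_funM => //.
  exact: measurable_int (Radon_Nikodym_SigmaFinite.f_integrable _).
- by apply: filterS (rn_density_ae numu) => x /(_ I) /= -> _.
Qed.

Hypothesis r01 : 0 < r <= 1.

Let r0 : 0 < r. Proof. by case/andP: r01. Qed.

Lemma pow_index_ge1 : (1 <= (r^-1)%:E)%E.
Proof. by rewrite lee_fin invf_ge1//; case/andP: r01. Qed.

Lemma pow_incl_measurable nu mu f : nu `<< mu ->
  measurable_fun setT f -> measurable_fun setT (pow_incl nu mu f).
Proof.
move=> numu mf; apply: measurable_funM => //.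
exact: (measurableT_comp (measurable_powR _) (rn_density_measurable numu)).
Qed.

Lemma Lnorm_pow_incl nu mu f : nu `<< mu -> measurable_fun setT f ->
  ('N[mu]_(r^-1)%:E[EFin \o pow_incl nu mu f] = 'N[nu]_(r^-1)%:E[EFin \o f])%E.
Proof.
move=> numu mf; rewrite unlock; congr (_ `^ _)%E.
have mfr : measurable_fun setT (fun x => (`|f x| `^ r^-1)%:E).
  apply/measurable_EFinP.
  by apply: (measurableT_comp (measurable_powR _)); exact: measurableT_comp.
transitivity (\int[nu]_x (`|f x| `^ r^-1)%:E)%E; last first.
  by [].
rewrite -(ge0_integral_rn_density numu)//.
apply: ae_eq_integral => //.
- apply/measurable_EFinP; apply: (measurableT_comp (measurable_powR _)).
  by apply: measurableT_comp => //; exact: pow_incl_measurable.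
- apply: emeasurable_funM => //; apply: measurableT_comp => //.
  exact: rn_density_measurable.
- apply: filterS (rn_density_ge0 numu) => x h0 _ /=.
  rewrite /pow_incl normrM (ger0_norm (powR_ge0 _ _)) powRM ?powR_ge0//.
  by rewrite -powRrM mulfV ?gt_eqF// powRr1// EFinM.
Qed.

Lemma pow_incl_trans nu mu la f : nu `<< mu -> mu `<< la ->
  \forall x \ae la, pow_incl mu la (pow_incl nu mu f) x = pow_incl nu la f x.
Proof.
move=> numu mula.
have nula : nu `<< la by exact: null_dominates_trans numu mula.
move: (rn_density_ge0 nula) (rn_density_ge0 mula) (rn_density_chain numu mula).
apply: filterS3 => x nula0 mula0 chain; rewrite /pow_incl -mulrA; congr (_ * _).
have [m0|mula1] := eqVneq (rn_density mu la x) 0.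
  by rewrite chain m0 !mulr0 powR0 ?gt_eqF// mulr0.
have mula_gt0 : 0 < rn_density mu la x by rewrite lt_def mula1.
by rewrite chain powRM// -(pmulr_lge0 _ mula_gt0) -chain.
Qed.

Let Lnorm_eq0P mu f : measurable_fun setT f ->
  ('N[mu]_(r^-1)%:E[EFin \o f] = 0)%E <-> \forall x \ae mu, f x = 0.
Proof.
move=> mf; split=> [N0|f0].
  have mEf : measurable_fun setT (EFin \o f) by exact/measurable_EFinP.
  have p0 : (0 < (r^-1)%:E)%E by rewrite lte_fin invr_gt0.
  by apply: filterS (Lnorm_eq0_eq0 mEf p0 N0) => x /(_ I) [].
rewrite -(@Lnorm0 _ _ _ mu (r^-1)%:E) ?gt_eqF ?lte_fin ?invr_gt0//.
rewrite !unlock; congr (_ `^ _)%E; apply: ae_eq_integral => //.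
- apply/measurable_EFinP; apply: (measurableT_comp (measurable_powR _)).
  exact: measurableT_comp.
- by apply: filterS f0 => x /= -> _.
Qed.

Lemma pow_incl_ae_eq nu mu f g : nu `<< mu ->
    measurable_fun setT f -> measurable_fun setT g ->
  (\forall x \ae nu, f x = g x) <->
  (\forall x \ae mu, pow_incl nu mu f x = pow_incl nu mu g x).
Proof.
move=> numu mf mg.
have mfg : measurable_fun setT (f \- g) by exact: measurable_funB.
have mifg := pow_incl_measurable numu mfg.
split=> fg.
  have : \forall x \ae mu, pow_incl nu mu (f \- g) x = 0.
    apply/Lnorm_eq0P => //; rewrite Lnorm_pow_incl//; apply/Lnorm_eq0P => //.
    by apply: filterS fg => x /= ->; rewrite subrr.
  by apply: filterS => x /eqP; rewrite /pow_incl mulrBl subr_eq0 => /eqP.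
have : \forall x \ae nu, (f \- g) x = 0.
  apply/Lnorm_eq0P => //; rewrite -(Lnorm_pow_incl numu)//.
  apply/Lnorm_eq0P => //; apply: filterS fg => x fg.
  by rewrite /pow_incl mulrBl; apply/eqP; rewrite subr_eq0; apply/eqP.
by apply: filterS => x /= /eqP; rewrite subr_eq0 => /eqP.
Qed.

End transition.

Section finite_measure_add.
Context {d : measure_display} {T : measurableType d} {R : realType}.
Variables mu nu : {finite_measure set T -> \bar R}.

Definition fm_add : set T -> \bar R := measure_add mu nu.

HB.instance Definition _ := Measure.on fm_add.

Let fm_add_fin : fin_num_fun fm_add.
Proof.
by move=> A mA; rewrite /fm_add measure_addE fin_numD !fin_num_measure.
Qed.

HB.instance Definition _ := Measure_isFinite.Build _ _ _ fm_add fm_add_fin.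

Lemma fm_add_dominatesl : mu `<< fm_add.
Proof.
apply/null_content_dominatesP => A mA /eqP; rewrite /= /fm_add measure_addE.
by rewrite padde_eq0// => /andP[/eqP].
Qed.

Lemma fm_add_dominatesr : nu `<< fm_add.
Proof.
apply/null_content_dominatesP => A mA /eqP; rewrite /= /fm_add measure_addE.
by rewrite padde_eq0// => /andP[_ /eqP].
Qed.

Lemma fm_add_dominates (la : {finite_measure set T -> \bar R}) :
  mu `<< la -> nu `<< la -> fm_add `<< la.
Proof.
move=> /null_content_dominatesP mula /null_content_dominatesP nula.
apply/null_content_dominatesP => A mA la0.
rewrite /fm_add measure_addE -[RHS]adde0.
by congr (_ + _)%E; [exact: mula|exact: nula].
Qed.

End finite_measure_add.

Section finite_measure_zero.
Context {d : measure_display} {T : measurableType d} {R : realType}.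

Definition fm_zero : set T -> \bar R := mzero.

HB.instance Definition _ := Measure.on fm_zero.

Let fm_zero_fin : fin_num_fun fm_zero. Proof. by []. Qed.

HB.instance Definition _ := Measure_isFinite.Build _ _ _ fm_zero fm_zero_fin.

Lemma fm_zero_dominates (mu : {finite_measure set T -> \bar R}) :
  fm_zero `<< mu.
Proof. by move=> A _ B. Qed.

End finite_measure_zero.

Section pow_rep.
Context {d : measure_display} (T : measurableType d) (R : realType) (r : R).

(* Representatives phi mu^r of the elements of the directed limit of the spaces
   L^(1/r)(mu). *)
Record pow_rep := PowRep {
  prep_mu : {finite_measure set T -> \bar R} ;
  prep_fun : T -> R ;
  prep_Lfun : prep_fun \in Lfun prep_mu (r^-1)%:E
}.

Definition prep_on (mu : {finite_measure set T -> \bar R}) (a : pow_rep) :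
  T -> R := pow_incl r (prep_mu a) mu (prep_fun a).

(* Two representatives are identified when their images coincide almost
   everywhere in L^(1/r)(mu) for some mu dominating both measures. *)
Definition pow_rep_eq (a b : pow_rep) : Prop :=
  exists mu : {finite_measure set T -> \bar R},
    [/\ prep_mu a `<< mu, prep_mu b `<< mu &
        \forall x \ae mu, prep_on mu a x = prep_on mu b x].

HB.instance Definition _ := gen_eqMixin pow_rep.
HB.instance Definition _ := gen_choiceMixin pow_rep.

End pow_rep.

Section pow_space.
Context {d : measure_display} (T : measurableType d) (R : realType) (r : R).
Hypothesis r01 : 0 < r <= 1.
Implicit Types (mu nu : {finite_measure set T -> \bar R}) (a b c : pow_rep T r).

Let dom2 a b : exists mu, [/\ prep_mu a `<< mu & prep_mu b `<< mu].
Proof.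
exists (fm_add (prep_mu a) (prep_mu b)).
by split; [exact: fm_add_dominatesl|exact: fm_add_dominatesr].
Qed.

Let dom3 a b c : exists mu,
  [/\ prep_mu a `<< mu, prep_mu b `<< mu & prep_mu c `<< mu].
Proof.
have [mu [amu bmu]] := dom2 a b; exists (fm_add mu (prep_mu c)).
split; last exact: fm_add_dominatesr.
- apply: (@null_dominates_trans _ _ _ _ mu) => //; exact: fm_add_dominatesl.
- apply: (@null_dominates_trans _ _ _ _ mu) => //; exact: fm_add_dominatesl.
Qed.

Let prep_measurable a : measurable_fun setT (prep_fun a).
Proof. by have /andP[+ _] := prep_Lfun a; rewrite inE. Qed.

Let prep_on_measurable mu a : prep_mu a `<< mu ->
  measurable_fun setT (prep_on mu a).
Proof. by move=> amu; exact: pow_incl_measurable. Qed.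

Let prep_on_trans nu mu a : prep_mu a `<< nu -> nu `<< mu ->
  \forall x \ae mu, pow_incl r nu mu (prep_on nu a) x = prep_on mu a x.
Proof. exact: pow_incl_trans. Qed.

Lemma pow_rep_eq_on a b mu : pow_rep_eq a b ->
  prep_mu a `<< mu -> prep_mu b `<< mu ->
  \forall x \ae mu, prep_on mu a x = prep_on mu b x.
Proof.
move=> [nu [anu bnu ab]] amu bmu.
have numunu : nu `<< fm_add nu mu by exact: fm_add_dominatesl.
have mumunu : mu `<< fm_add nu mu by exact: fm_add_dominatesr.
apply/(pow_incl_ae_eq r01 mumunu (prep_on_measurable amu)
  (prep_on_measurable bmu)).
have H := (pow_incl_ae_eq r01 numunu (prep_on_measurable anu)
  (prep_on_measurable bnu)).1 ab.
have E (e : pow_rep T r) : prep_mu e `<< mu -> prep_mu e `<< nu ->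
    \forall x \ae fm_add nu mu, pow_incl r mu (fm_add nu mu) (prep_on mu e) x =
                               pow_incl r nu (fm_add nu mu) (prep_on nu e) x.
  move=> emu enu.
  move: (prep_on_trans emu mumunu) (prep_on_trans enu numunu).
  by apply: filterS2 => x -> ->.
by move: H (E _ amu anu) (E _ bmu bnu); apply: filterS3 => x h -> ->.
Qed.

Definition pow_rep_eqb a b := `[< pow_rep_eq a b >].

Let pow_rep_eqb_refl : reflexive pow_rep_eqb.
Proof.
by move=> a; apply/asboolP; exists (prep_mu a); split => //; exact: aeW.
Qed.

Let pow_rep_eqb_sym : symmetric pow_rep_eqb.
Proof.
by move=> a b; apply/asboolP/asboolP => -[mu [amu bmu ab]];
  exists mu; split => //; apply: filterS ab.
Qed.

Let pow_rep_eqb_trans : transitive pow_rep_eqb.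
Proof.
move=> b a c /asboolP ab /asboolP bc; apply/asboolP.
have [mu [amu bmu cmu]] := dom3 a b c.
exists mu; split => //.
by apply: filterS2 (pow_rep_eq_on ab amu bmu) (pow_rep_eq_on bc bmu cmu) => x -> ->.
Qed.

Canonical pow_rep_equiv :=
  EquivRel pow_rep_eqb pow_rep_eqb_refl pow_rep_eqb_sym pow_rep_eqb_trans.

Local Open Scope quotient_scope.

(* The space S^r(T) of r-th powers of measures. *)
Definition pow_space : Type := {eq_quot pow_rep_eqb}.

HB.instance Definition _ := Choice.on pow_space.
HB.instance Definition _ := EqQuotient.on pow_space.
Implicit Types u v w : pow_space.

Definition pow_elt a : pow_space := \pi_pow_space a.

Lemma pow_eltP a b : pow_elt a = pow_elt b <-> pow_rep_eq a b.
Proof. by split=> [/eqmodP/asboolP|ab]; last exact/eqmodP/asboolP. Qed.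

Lemma pow_elt_on a b mu : prep_mu a `<< mu -> prep_mu b `<< mu ->
  (\forall x \ae mu, prep_on mu a x = prep_on mu b x) -> pow_elt a = pow_elt b.
Proof. by move=> amu bmu ab; apply/pow_eltP; exists mu. Qed.

Lemma pow_eltK u : pow_elt (repr u) = u.
Proof. exact: reprK. Qed.

Lemma pow_elt_repr a : pow_rep_eq (repr (pow_elt a)) a.
Proof. by apply/pow_eltP; rewrite pow_eltK. Qed.

Let Lfun_lin mu (k : R) f g : f \in Lfun mu (r^-1)%:E ->
  g \in Lfun mu (r^-1)%:E -> k *: f + g \in Lfun mu (r^-1)%:E.
Proof. by have [_] := Lfun_submod_closed mu (pow_index_ge1 r01); apply. Qed.

Let Lfun_zero mu : 0 \in @Lfun _ T R mu (r^-1)%:E.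
Proof. by have [] := Lfun_submod_closed mu (pow_index_ge1 r01). Qed.

Let prep_on_Lfun mu a : prep_mu a `<< mu ->
  prep_on mu a \in Lfun mu (r^-1)%:E.
Proof.
move=> amu; apply/andP; rewrite !inE; split; first exact: prep_on_measurable.
rewrite /finite_norm /= Lnorm_pow_incl//.
by have /andP[_] := prep_Lfun a; rewrite inE.
Qed.

Definition prep_zero : pow_rep T r := PowRep (Lfun_zero fm_zero).

Definition prep_scale_subproof k a :
  k *: prep_fun a \in Lfun (prep_mu a) (r^-1)%:E.
Proof. by rewrite -[_ *: _]addr0; apply: Lfun_lin => //; exact: prep_Lfun. Qed.

Definition prep_scale k a : pow_rep T r := PowRep (prep_scale_subproof k a).

Definition prep_add_subproof a b :
  prep_on (fm_add (prep_mu a) (prep_mu b)) a +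
  prep_on (fm_add (prep_mu a) (prep_mu b)) b \in
  Lfun (fm_add (prep_mu a) (prep_mu b)) (r^-1)%:E.
Proof.
rewrite -[X in X + _]scale1r.
apply: Lfun_lin; apply: prep_on_Lfun.
- exact: fm_add_dominatesl.
- exact: fm_add_dominatesr.
Qed.

Definition prep_add a b : pow_rep T r := PowRep (prep_add_subproof a b).

Let prep_on0 mu x : prep_on mu prep_zero x = 0.
Proof. by rewrite /prep_on /pow_incl mul0r. Qed.

Let prep_onZ mu k a x : prep_on mu (prep_scale k a) x = k * prep_on mu a x.
Proof. by rewrite /prep_on /pow_incl mulrA. Qed.

Let prep_onD mu a b : prep_mu a `<< mu -> prep_mu b `<< mu ->
  \forall x \ae mu,
    prep_on mu (prep_add a b) x = prep_on mu a x + prep_on mu b x.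
Proof.
move=> amu bmu.
have ambm := fm_add_dominates amu bmu.
have al := @fm_add_dominatesl _ _ _ (prep_mu a) (prep_mu b).
have ar := @fm_add_dominatesr _ _ _ (prep_mu a) (prep_mu b).
move: (@prep_on_trans _ mu a al ambm) (@prep_on_trans _ mu b ar ambm).
by apply: filterS2 => x <- <-; rewrite /prep_on /pow_incl -mulrDl.
Qed.

Definition pow_zero : pow_space := pow_elt prep_zero.
Definition pow_scale (k : R) u : pow_space := pow_elt (prep_scale k (repr u)).
Definition pow_opp u : pow_space := pow_scale (-1) u.
Definition pow_add u v : pow_space := pow_elt (prep_add (repr u) (repr v)).

Lemma pow_scale_elt k a : pow_scale k (pow_elt a) = pow_elt (prep_scale k a).
Proof.
have [mu [amu rmu]] := dom2 a (repr (pow_elt a)).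
apply: (pow_elt_on (mu := mu)) => //.
by apply: filterS (pow_rep_eq_on (pow_elt_repr a) rmu amu) => x; rewrite !prep_onZ => ->.
Qed.

Lemma pow_add_elt a b :
  pow_add (pow_elt a) (pow_elt b) = pow_elt (prep_add a b).
Proof.
have [mu1 [amu1 ramu1]] := dom2 a (repr (pow_elt a)).
have [mu2 [bmu2 rbmu2]] := dom2 b (repr (pow_elt b)).
pose mu := fm_add mu1 mu2.
have mu1mu : mu1 `<< mu by exact: fm_add_dominatesl.
have mu2mu : mu2 `<< mu by exact: fm_add_dominatesr.
have amu := null_dominates_trans amu1 mu1mu.
have ramu := null_dominates_trans ramu1 mu1mu.
have bmu := null_dominates_trans bmu2 mu2mu.
have rbmu := null_dominates_trans rbmu2 mu2mu.
apply: (pow_elt_on (mu := mu)); [exact: fm_add_dominates..|].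
have E : \forall x \ae mu,
    prep_on mu (repr (pow_elt a)) x + prep_on mu (repr (pow_elt b)) x =
    prep_on mu a x + prep_on mu b x.
  move: (pow_rep_eq_on (pow_elt_repr a) ramu amu).
  move: (pow_rep_eq_on (pow_elt_repr b) rbmu bmu).
  by apply: filterS2 => x -> ->.
move: E (prep_onD ramu rbmu) (prep_onD amu bmu).
by apply: filterS3 => x h -> ->.
Qed.

Lemma pow_addA : associative pow_add.
Proof.
move=> u v w; rewrite -(pow_eltK u) -(pow_eltK v) -(pow_eltK w).
move: (repr u) (repr v) (repr w) => a b c; rewrite !pow_add_elt.
have [mu [amu bmu cmu]] := dom3 a b c.
have abmu := fm_add_dominates amu bmu; have bcmu := fm_add_dominates bmu cmu.
apply: (pow_elt_on (mu := mu)); [exact: fm_add_dominates..|].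
have L : \forall x \ae mu, prep_on mu (prep_add a (prep_add b c)) x =
    prep_on mu a x + (prep_on mu b x + prep_on mu c x).
  move: (@prep_onD _ a (prep_add b c) amu bcmu) (prep_onD bmu cmu).
  by apply: filterS2 => x -> ->.
have M : \forall x \ae mu, prep_on mu (prep_add (prep_add a b) c) x =
    prep_on mu a x + prep_on mu b x + prep_on mu c x.
  move: (@prep_onD _ (prep_add a b) c abmu cmu) (prep_onD amu bmu).
  by apply: filterS2 => x -> ->.
by move: L M; apply: filterS2 => x -> ->; rewrite addrA.
Qed.

Lemma pow_addC : commutative pow_add.
Proof.
move=> u v; rewrite -(pow_eltK u) -(pow_eltK v).
move: (repr u) (repr v) => a b; rewrite !pow_add_elt.
have [mu [amu bmu]] := dom2 a b.
apply: (pow_elt_on (mu := mu)); [exact: fm_add_dominates..|].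
move: (prep_onD amu bmu) (prep_onD bmu amu).
by apply: filterS2 => x -> ->; rewrite addrC.
Qed.

Lemma pow_add0 : left_id pow_zero pow_add.
Proof.
move=> u; rewrite -(pow_eltK u); move: (repr u) => a; rewrite pow_add_elt.
have zmu := @fm_zero_dominates _ T R (prep_mu a).
apply: (pow_elt_on (mu := prep_mu a)) => //; first exact: fm_add_dominates.
have := @prep_onD (prep_mu a) prep_zero a zmu (fun=> id).
by apply: filterS => x ->; rewrite prep_on0 add0r.
Qed.

Lemma pow_addN : left_inverse pow_zero pow_opp pow_add.
Proof.
move=> u; rewrite -(pow_eltK u); move: (repr u) => a.
rewrite /pow_opp pow_scale_elt pow_add_elt.
have zmu := @fm_zero_dominates _ T R (prep_mu a).
apply: (pow_elt_on (mu := prep_mu a)) => //; first exact: fm_add_dominates.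
have := @prep_onD (prep_mu a) (prep_scale (-1) a) a (fun=> id) (fun=> id).
by apply: filterS => x ->; rewrite prep_on0 prep_onZ mulN1r addNr.
Qed.

HB.instance Definition _ :=
  GRing.isZmodule.Build pow_space pow_addA pow_addC pow_add0 pow_addN.

Lemma pow_scaleA k l u : pow_scale k (pow_scale l u) = pow_scale (k * l) u.
Proof.
rewrite -(pow_eltK u); move: (repr u) => a; rewrite !pow_scale_elt.
apply: (pow_elt_on (mu := prep_mu a)) => //.
by apply: aeW => x; rewrite !prep_onZ mulrA.
Qed.

Lemma pow_scale1 : left_id 1 pow_scale.
Proof.
move=> u; rewrite -(pow_eltK u); move: (repr u) => a; rewrite !pow_scale_elt.
apply: (pow_elt_on (mu := prep_mu a)) => //.
by apply: aeW => x; rewrite !prep_onZ mul1r.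
Qed.

Lemma pow_scaleDr : right_distributive pow_scale +%R.
Proof.
move=> k u v; rewrite -[_ + _]/(pow_add _ _) -[RHS]/(pow_add _ _).
rewrite -(pow_eltK u) -(pow_eltK v); move: (repr u) (repr v) => a b.
rewrite pow_add_elt !pow_scale_elt pow_add_elt.
have [mu [amu bmu]] := dom2 a b.
apply: (pow_elt_on (mu := mu)); [exact: fm_add_dominates..|].
move: (prep_onD amu bmu) (@prep_onD mu (prep_scale k a) (prep_scale k b) amu bmu).
by apply: filterS2 => x h ->; rewrite !prep_onZ h mulrDr.
Qed.

Lemma pow_scaleDl u : {morph pow_scale^~ u : k l / k + l}.
Proof.
move=> k l; rewrite -[RHS]/(pow_add _ _).
rewrite -(pow_eltK u); move: (repr u) => a.
rewrite !pow_scale_elt !pow_add_elt.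
apply: (pow_elt_on (mu := prep_mu a)) => //; first exact: fm_add_dominates.
have := @prep_onD (prep_mu a) (prep_scale k a) (prep_scale l a) (fun=> id) (fun=> id).
by apply: filterS => x ->; rewrite !prep_onZ mulrDl.
Qed.

HB.instance Definition _ := GRing.Zmodule_isLmodule.Build R pow_space
  pow_scaleA pow_scale1 pow_scaleDr pow_scaleDl.

Definition prep_norm a : \bar R :=
  'N[prep_mu a]_(r^-1)%:E[EFin \o prep_fun a]%E.

Definition pow_norm u : R := fine (prep_norm (repr u)).

Lemma prep_norm_on mu a : prep_mu a `<< mu ->
  'N[mu]_(r^-1)%:E[EFin \o prep_on mu a]%E = prep_norm a.
Proof. by move=> amu; exact: Lnorm_pow_incl. Qed.

Lemma Lnorm_ae_eq mu (f g : T -> R) :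
    measurable_fun setT f -> measurable_fun setT g ->
    (\forall x \ae mu, f x = g x) ->
  ('N[mu]_(r^-1)%:E[EFin \o f] = 'N[mu]_(r^-1)%:E[EFin \o g])%E.
Proof.
move=> mf mg fg; rewrite unlock; congr (_ `^ _)%E.
have mp (h : T -> R) : measurable_fun setT h ->
    measurable_fun setT (fun x => `|(EFin \o h) x| `^ r^-1)%E.
  move=> mh; apply/measurable_EFinP.
  by apply: (measurableT_comp (measurable_powR _)); exact: measurableT_comp.
apply: ae_eq_integral => //; [exact: mp..|].
by apply: filterS fg => x /= -> _.
Qed.

Lemma prep_norm_eq a b : pow_rep_eq a b -> prep_norm a = prep_norm b.
Proof.
move=> [mu [amu bmu ab]]; rewrite -(prep_norm_on amu) -(prep_norm_on bmu).
by apply: Lnorm_ae_eq => //; exact: prep_on_measurable.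
Qed.

Lemma prep_norm_fin a : prep_norm a \is a fin_num.
Proof.
have /andP[_] := prep_Lfun a; rewrite inE /finite_norm => a_fin.
by rewrite ge0_fin_numE// Lnorm_ge0.
Qed.

Lemma pow_norm_elt a : (pow_norm (pow_elt a))%:E = prep_norm a.
Proof.
by rewrite fineK ?prep_norm_fin//; apply: prep_norm_eq; exact: pow_elt_repr.
Qed.

Lemma pow_normD u v : pow_norm (u + v) <= pow_norm u + pow_norm v.
Proof.
rewrite -[u + v]/(pow_add _ _) -(pow_eltK u) -(pow_eltK v).
move: (repr u) (repr v) => a b.
rewrite pow_add_elt -lee_fin EFinD !pow_norm_elt.
have [mu [amu bmu]] := dom2 a b.
rewrite -(prep_norm_on amu) -(prep_norm_on bmu).
rewrite -(@prep_norm_on mu); last exact: fm_add_dominates.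
have ma := prep_on_measurable amu; have mb := prep_on_measurable bmu.
rewrite (Lnorm_ae_eq _ _ (prep_onD amu bmu)).
- apply: eminkowski => //; exact: pow_index_ge1.
- by apply: prep_on_measurable; exact: fm_add_dominates.
- exact: measurable_funD.
Qed.

Lemma pow_normZ k u : pow_norm (k *: u) = `|k| * pow_norm u.
Proof.
rewrite -[k *: u]/(pow_scale _ _) -(pow_eltK u); move: (repr u) => a.
apply: EFin_inj; rewrite pow_scale_elt EFinM !pow_norm_elt.
exact: LnormZ (Lfun_Sub (pow_index_ge1 r01) (prep_Lfun a)) k.
Qed.

Lemma pow_norm0_eq0 u : pow_norm u = 0 -> u = 0.
Proof.
rewrite -(pow_eltK u); move: (repr u) => a na0.
have a0 : prep_norm a = 0%E by rewrite -pow_norm_elt na0.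
rewrite -[RHS]/(pow_elt prep_zero).
apply: (pow_elt_on (mu := prep_mu a)) => //.
have : \forall x \ae prep_mu a, prep_fun a x = 0.
  have mEf : measurable_fun setT (EFin \o prep_fun a) by exact/measurable_EFinP.
  have p0 : (0 < (r^-1)%:E)%E by rewrite lte_fin invr_gt0; case/andP: r01.
  by apply: filterS (Lnorm_eq0_eq0 mEf p0 a0) => x /(_ I) [].
by apply: filterS => x ax; rewrite prep_on0 /prep_on /pow_incl ax mul0r.
Qed.

HB.instance Definition _ := Lmodule_isNormed.Build R pow_space
  pow_normD pow_normZ pow_norm0_eq0.

End pow_space.

Section pow_measure.
Context {d : measure_display} {T : measurableType d} {R : realType} (r : R).
Hypothesis r01 : 0 < r <= 1.

(* The r-th power mu^r of a finite measure mu. *)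
Definition pow_measure (mu : {finite_measure set T -> \bar R}) :
  pow_space T r01 := pow_elt r01 (PowRep (Lfun_cst mu 1 r^-1)).

End pow_measure.

Lemma invr_gt0_le1 {R : realType} (l : R) : 1 <= l -> 0 < l^-1 <= 1.
Proof.
by move=> l1; rewrite invr_gt0 (lt_le_trans ltr01 l1) invf_le1// (lt_le_trans ltr01 l1).
Qed.

Section measure_model.
Context {d : measure_display} {T : measurableType d} {R : realType}.
Context {M : banachManifold R} (p : M -> {finite_measure set T -> \bar R}).
Implicit Types (xi : M) (phi : T -> R).

Definition parametrized_measure_model : Prop :=
  C1_map (fun xi => sm_of_measure (p xi)).

Definition integrable_model (l : R) (l1 : 1 <= l) : Prop :=
  C1_map (fun xi => pow_measure (invr_gt0_le1 l1) (p xi)).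

Local Open Scope charge_scope.

(* The total function ['d _ '/d _] is the Radon-Nikodym derivative whenever its
   first argument is absolutely continuous, which is the case here. *)
Definition log_derivative xi (X : tangent xi) (x : T) : R :=
  fine (('d (diff_along (fun xi => sm_of_measure (p xi)) X) '/d (p xi)) x).

(* The limsup also takes the value at xi0 into account; this is harmless as that
   value is finite. *)
Definition regular (k : R) phi : Prop :=
  (forall xi, phi \in Lfun (p xi) k%:E) /\
  forall xi0 : M,
    (limf_esup (fun xi : M => 'N[p xi]_k%:E[EFin \o phi]) (nbhs xi0) < +oo)%E.

End measure_model.

(* Main.v *)
Require Import Defs.
From mathcomp Require Import all_boot all_order all_algebra.
From mathcomp Require Import all_classical all_reals all_analysis.
From mathcomp Require Import measurable_realfun ring lra.
Import Order.TTheory GRing.Theory Num.Theory.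
Import numFieldNormedType.Exports.

(** Write k' for the index dual to k, and let y move along a line through a
    point a of a chart, in a direction v.  Let Q and G be the derivatives at a,
    in the direction v, of y |-> p(y) in the space of signed measures and of
    y |-> p(y)^(1/k') in the space of powers.  The signed measure Q is
    absolutely continuous with respect to p(a), since p(y)(A) is minimal at a
    when p(a)(A) = 0 ([diff_measure_dominated]); let l be its density, which is
    the logarithmic derivative.  The difference quotients of the integral of phi
    have to converge to the integral of phi * l with respect to p(a).

    For bounded phi, this is immediate from the convergence in total variation.
    In general, phi is truncated at height n, and the set where |phi| > n is
    controlled by the differentiability of p^(1/k').  Namely, if p(a) and p(y)
    have densities u^k' and w^k' with respect to a common measure, then
      |w^k' - u^k'| <= k' (w^(k'-1) + u^(k'-1)) |w - u|
    ([powR_sub_le]), and k (k' - 1) = k', so that Hoelder's inequality bounds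
    the integral of |phi| |w^k' - u^k'| over a set A by
      k' (||phi||_{L^k(p(y))} + ||phi||_{L^k(p(a))}) ||1_A (w - u)||_{k'}
    ([integral_density_sub_le]).  By regularity the first factor is at most
    K = 2 C k' for y close to a.  Divided by the increment of the parameter, the
    second one is at most ||1_A G|| plus an error that tends to 0 with the
    increment.  This has two consequences.

    - With A the whole space, and phi truncated: the integral of |phi * l| is at
      most K ||G|| ([integral_diff_le]).  Hence phi * l is integrable, and its
      integral is continuous in v, because G is a bounded linear function of v.
    - With A the set where |phi| > n: the error made by truncating is at most
      K ||1_A G|| plus the integral of |phi * l| over A, up to a vanishing error
      ([diff_quot_Rintegral_le]).  Both tend to 0 as n grows, by dominated
      convergence, so n may be chosen first and the increment afterwards.

    Each estimate compares the two points a and y only, so that it takes place in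
    the spaces L^1 and L^k' of a single measure that dominates p(a), p(y) and a
    representative of G. *)

Set Implicit Arguments.
Unset Strict Implicit.
Unset Printing Implicit Defensive.

Local Open Scope classical_set_scope.
Local Open Scope ring_scope.

(** * Hoelder estimate for differences of densities *)

(** Young's inequality for y and x^(p-1), whose q-th power is x^p, is the
    tangent inequality of the convex function t |-> t^p. *)
Lemma powR_sub_le (R : realType) (p q x y : R) :
    1 < p -> q^-1 + p^-1 = 1 -> 0 <= x -> 0 <= y ->
  `|x `^ p - y `^ p| <= p * (x `^ (p - 1) + y `^ (p - 1)) * `|x - y|.
Proof.
move=> p1 qp.
have p0 : 0 < p by exact: lt_trans p1.
have q0 : 0 < q by rewrite -invr_gt0; have := invf_lt1 p0; rewrite p1; lra.
have pq : (p - 1) * q = p.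
  have -> : q = (1 - p^-1)^-1 by rewrite -[LHS]invrK; congr (_^-1); lra.
  by rewrite -[X in (X - 1) * _]invrK; field; rewrite ?gt_eqF//= ?subr_gt0.
wlog xy : x y / y <= x.
  move=> H x0 y0; have [yx|/ltW xy] := leP y x; first exact: H.
  by rewrite distrC (distrC x) [X in p * X]addrC H.
move=> x0 y0.
have := @conjugate_powR R y (x `^ (p - 1)) p q y0 (powR_ge0 _ _) p0 q0.
rewrite addrC qp -powRrM pq => /(_ erefl).
have qi : q^-1 = 1 - p^-1 by lra.
rewrite qi => Y.
have xp : x `^ p = x * x `^ (p - 1).
  have [->|xn0] := eqVneq x 0; first by rewrite powR0 ?mul0r ?gt_eqF.
  by rewrite -{2}[x]powRr1// -powRD ?xn0 ?implybT//; congr (_ `^ _); lra.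
rewrite ger0_norm ?subr_ge0; last by apply: ge0_ler_powR; rewrite ?nnegrE// ltW.
rewrite ger0_norm ?subr_ge0//.
have Y' : p * (y * x `^ (p - 1)) <= y `^ p + (p - 1) * x `^ p.
  rewrite -ler_pdivlMl// (le_trans Y)// le_eqVlt; apply/orP; left; apply/eqP.
  by field; rewrite gt_eqF.
apply: (@le_trans _ _ (p * x `^ (p - 1) * (x - y))).
  have -> : p * x `^ (p - 1) * (x - y) = p * x `^ p - p * (y * x `^ (p - 1)).
    by rewrite xp; ring.
  lra.
apply: ler_wpM2r; first by rewrite subr_ge0.
by apply: ler_wpM2l; [exact: ltW|rewrite lerDl powR_ge0].
Qed.

Section densities.
Context {d : measure_display} {T : measurableType d} {R : realType}.
Implicit Types mu nu q : {finite_measure set T -> \bar R}.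
Local Open Scope charge_scope.

(** The two sets where the density is nonnegative and negative are disjoint, and
    the total variation bounds the sum of the absolute masses of such sets. *)
Lemma integral_normr_le_tv mu (nu : signed_measure T R) (D : T -> R) :
    mu.-integrable setT (EFin \o D) ->
    (forall A, measurable A -> nu A = \int[mu]_(x in A) (D x)%:E)%E ->
  (\int[mu]_x `|D x|%:E <= (tv_norm nu)%:E)%E.
Proof.
move=> iD nuE.
have mD : measurable_fun setT D by apply/measurable_EFinP; exact: measurable_int iD.
pose P := [set x | 0 <= D x].
have mP : measurable P.
  rewrite (_ : P = D @^-1` `[0, +oo[).
    by rewrite -[X in measurable X]setTI; exact: mD.
  by apply/seteqP; split=> x; rewrite /P/= in_itv/= andbT.
have mN : measurable (~` P) by exact: measurableC.
have absI A (s : R) : measurable A -> `|s| = 1 ->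
    (forall x, A x -> `|D x| = s * D x) ->
    (\int[mu]_(x in A) `|D x|%:E = `|nu A|)%E.
  move=> mA s1 DA; rewrite nuE//.
  have E : (\int[mu]_(x in A) `|D x|%:E = s%:E * \int[mu]_(x in A) (D x)%:E)%E.
    rewrite -integralZl//; last exact: integrableS iD.
    by apply: eq_integral => x /[!inE] /DA ->; rewrite EFinM.
  have : (0 <= \int[mu]_(x in A) `|D x|%:E)%E by apply: integral_ge0.
  by move=> /gee0_abs <-; rewrite E abseM /= s1 mul1e.
have PT : P `|` ~` P = setT by rewrite setUv.
have dPN : [disjoint P & ~` P] by apply/disj_setPS; rewrite setICr.
rewrite -PT ge0_integral_setU//=; last first.
  rewrite PT; apply/measurable_EFinP; exact: measurableT_comp.
rewrite (absI P 1) ?normr1//; last by move=> x Px; rewrite mul1r ger0_norm.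
rewrite (absI (~` P) (-1)) ?normrN1//; last first.
  by move=> x /= /negP; rewrite -ltNge => Dx; rewrite mulN1r ltr0_norm.
by apply: le_tv_norm => //; rewrite setICr.
Qed.

Lemma integral_rn_density mu nu (f : T -> R) A : nu `<< mu ->
    measurable A -> nu.-integrable setT (EFin \o f) ->
  (\int[mu]_(x in A) (f x * rn_density nu mu x)%:E = \int[nu]_(x in A) (f x)%:E)%E.
Proof.
move=> numu mA fi; rewrite -(Radon_Nikodym_change_of_variables numu)//.
  by apply: eq_integral => x _; rewrite -rn_densityE.
exact: integrableS fi.
Qed.

Lemma integrable_rn_density mu nu (f : T -> R) : nu `<< mu ->
    nu.-integrable setT (EFin \o f) ->
  mu.-integrable setT (fun x => (f x * rn_density nu mu x)%:E).
Proof.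
move=> numu fi.
have mf : measurable_fun setT f by apply/measurable_EFinP; exact: measurable_int fi.
have mr := rn_density_measurable numu.
apply/integrableP; split; first by apply/measurable_EFinP; exact: measurable_funM.
rewrite (_ : (\int[mu]_x _)%E = (\int[mu]_x (`|f x|%:E * (rn_density nu mu x)%:E))%E).
  rewrite ge0_integral_rn_density//.
    by case/integrableP : fi.
  by apply/measurable_EFinP; exact: measurableT_comp.
apply: ae_eq_integral => //.
- by apply/measurable_EFinP; apply: measurableT_comp => //; exact: measurable_funM.
- by apply/measurable_EFinP; apply: measurable_funM => //; exact: measurableT_comp.
- apply: filterS (rn_density_ge0 numu) => x r0 _ /=.
  by rewrite -EFinM normrM (ger0_norm r0).
Qed.

Lemma rn_density_powR_measurable mu nu (e : R) : nu `<< mu ->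
  measurable_fun setT (fun x => rn_density nu mu x `^ e).
Proof.
move=> numu.
exact: (measurableT_comp (measurable_powR _) (rn_density_measurable numu)).
Qed.

(** The weight chi is meant to be an indicator function, up to a scalar.  It is
    kept with the second factor in Hoelder's inequality, where it localizes the
    norm of the difference of the k'-th roots; the first factor f w^(k'-1) is
    the image of f under the isometric inclusion of L^k(q) in L^k(mu). *)
Lemma integral_density_sub_le mu q0 q1 (k k' C : R) (f chi : T -> R) :
    1 < k -> 1 < k' -> k^-1 + k'^-1 = 1 -> q0 `<< mu -> q1 `<< mu ->
    measurable_fun setT f -> measurable_fun setT chi -> (forall x, 0 <= chi x) ->
    ('N[q0]_k%:E[EFin \o f] <= C%:E)%E -> ('N[q1]_k%:E[EFin \o f] <= C%:E)%E ->
  (\int[mu]_x (chi x * `|f x * (rn_density q1 mu x - rn_density q0 mu x)|)%:E <=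
   (k' * (C + C))%:E * 'N[mu]_k'%:E[EFin \o (fun x => chi x *
     (rn_density q1 mu x `^ k'^-1 - rn_density q0 mu x `^ k'^-1))%R])%E.
Proof.
move=> k1 k'1 dual q0mu q1mu mf mchi chi0 C0 C1.
have k0 : 0 < k by exact: lt_trans k1.
have k'0 : 0 < k' by exact: lt_trans k'1.
have mr0 := rn_density_measurable q0mu; have mr1 := rn_density_measurable q1mu.
pose h x := chi x * (rn_density q1 mu x `^ k'^-1 - rn_density q0 mu x `^ k'^-1).
have mh : measurable_fun setT h.
  by apply: measurable_funM => //; apply: measurable_funB;
    exact: rn_density_powR_measurable.
(* By duality f u^(k'-1) = f rho^(1/k), for the density rho = u^k'. *)
have kr : k'^-1 * (k' - 1) = k^-1.
  by rewrite mulrBr mulVf ?gt_eqF// mulr1; lra.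
have H q : q `<< mu -> ('N[q]_k%:E[EFin \o f] <= C%:E)%E ->
    (\int[mu]_x `|pow_incl k^-1 q mu f x * h x|%:E <= C%:E * 'N[mu]_k'%:E[EFin \o h])%E.
  move=> qmu qC.
  have mg : measurable_fun setT (pow_incl k^-1 q mu f) by exact: pow_incl_measurable.
  have := @hoelder _ _ _ mu (pow_incl k^-1 q mu f) h k k' mg mh k0 k'0 dual.
  rewrite Lnorm1 => /le_trans; apply.
  apply: lee_wpmul2r; first exact: Lnorm_ge0.
  apply: le_trans qC; have ik : 0 < k^-1 <= 1 by exact/invr_gt0_le1/ltW.
  by have := Lnorm_pow_incl ik qmu mf; rewrite invrK => ->.
have mG q : q `<< mu ->
    measurable_fun setT (fun x => `|pow_incl k^-1 q mu f x * h x|%:E).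
  move=> qmu; apply/measurable_EFinP; apply: measurableT_comp => //.
  by apply: measurable_funM => //; exact: pow_incl_measurable.
apply: (@le_trans _ _ (\int[mu]_x (k'%:E * (`|pow_incl k^-1 q1 mu f x * h x|%:E +
    `|pow_incl k^-1 q0 mu f x * h x|%:E)))%E).
  apply: ae_ge0_le_integral => //.
  - by move=> x _; rewrite lee_fin mulr_ge0.
  - apply/measurable_EFinP; apply: measurable_funM => //.
    by apply: measurableT_comp => //; apply: measurable_funM => //; exact: measurable_funB.
  - by move=> x _; rewrite -EFinD -EFinM lee_fin mulr_ge0 ?addr_ge0// ltW.
  - by apply: emeasurable_funM => //; apply: emeasurable_funD; exact: mG.
  - apply: filterS2 (rn_density_ge0 q0mu) (rn_density_ge0 q1mu) => x r0 r1 _.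
    rewrite -EFinD -EFinM lee_fin.
    have E r : 0 <= r -> r = (r `^ k'^-1) `^ k'.
      by move=> r0'; rewrite -powRrM mulVf ?gt_eqF// powRr1.
    rewrite [in leLHS](E _ r0) [in leLHS](E _ r1).
    have E' q : pow_incl k^-1 q mu f x = f x * (rn_density q mu x `^ k'^-1) `^ (k' - 1).
      by rewrite -powRrM kr.
    rewrite (E' q0) (E' q1) /h.
    move: (powR_ge0 (rn_density q0 mu x) k'^-1) (powR_ge0 (rn_density q1 mu x) k'^-1).
    move: (_ `^ _) (_ `^ _) => u0 u1 u0_ge0 u1_ge0.
    rewrite !normrM (ger0_norm (powR_ge0 u0 _)) (ger0_norm (powR_ge0 u1 _)).
    rewrite (ger0_norm (chi0 x)).
    have := powR_sub_le k'1 dual u1_ge0 u0_ge0.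
    move=> /(@ler_wpM2l _ (chi x * `|f x|) (mulr_ge0 (chi0 x) (normr_ge0 _))).
    by congr (_ <= _); ring.
rewrite ge0_integralZl//; last 3 first.
- by apply: emeasurable_funD; exact: mG.
- by move=> x _; rewrite -EFinD lee_fin addr_ge0.
- by rewrite lee_fin ltW.
rewrite ge0_integralD//; [|exact: mG..].
have NC0 : (0 <= 'N[mu]_k'%:E[EFin \o h])%E by exact: Lnorm_ge0.
have C_ge0 : 0 <= C by rewrite -lee_fin (le_trans _ C0)// Lnorm_ge0.
rewrite EFinM -muleA; apply: lee_wpmul2l; first by rewrite lee_fin ltW.
rewrite EFinD ge0_muleDl ?lee_fin//.
by apply: leeD; exact: H.
Qed.

End densities.

(** * Norms in the space of powers *)

Lemma le_Lnorm d (T : measurableType d) (R : realType)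
    (mu : {finite_measure set T -> \bar R}) (p : R) (f g : T -> R) :
    0 < p -> measurable_fun setT f -> measurable_fun setT g ->
    (forall x, `|f x| <= `|g x|) ->
  ('N[mu]_p%:E[EFin \o f] <= 'N[mu]_p%:E[EFin \o g])%E.
Proof.
move=> p0 mf mg fg; rewrite unlock.
have m (h : T -> R) : measurable_fun setT h ->
    measurable_fun setT (fun x => `|(EFin \o h) x| `^ p)%E.
  move=> mh; apply/measurable_EFinP.
  by apply: (measurableT_comp (measurable_powR _)); exact: measurableT_comp.
have ge0 (h : T -> R) : (0 <= \int[mu]_x (`|(EFin \o h) x| `^ p))%E.
  by apply: integral_ge0 => x _; exact: poweR_ge0.
apply: gt0_ler_poweR.
- by rewrite invr_ge0 ltW.
- by rewrite in_itv/= ge0 leey.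
- by rewrite in_itv/= ge0 leey.
apply: ge0_le_integral => //.
- by move=> x _; exact: poweR_ge0.
- exact: (m f).
- exact: (m g).
- by move=> x _; rewrite lee_fin; apply: ge0_ler_powR; rewrite ?nnegrE//; exact: ltW.
Qed.

Section pow_space_norm.
Context {d : measure_display} {T : measurableType d} {R : realType} (r : R).
Hypothesis r01 : 0 < r <= 1.
Implicit Types (mu nu : {finite_measure set T -> \bar R}) (a b c : pow_rep T r).

Lemma prep_fun_measurable a : measurable_fun setT (prep_fun a).
Proof. by have /andP[+ _] := prep_Lfun a; rewrite inE. Qed.

Lemma prep_on_measurable mu a : prep_mu a `<< mu ->
  measurable_fun setT (prep_on mu a).
Proof. by move=> amu; apply: pow_incl_measurable => //; exact: prep_fun_measurable. Qed.

Lemma pow_elt_lin (s : R) a b :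
  pow_elt r01 a + s *: pow_elt r01 b = pow_elt r01 (prep_add r01 a (prep_scale r01 s b)).
Proof.
rewrite -[s *: _]/(pow_scale _ _) pow_scale_elt.
by rewrite -[LHS]/(pow_add _ _) pow_add_elt.
Qed.

Lemma prep_on_lin mu (s : R) a b : prep_mu a `<< mu -> prep_mu b `<< mu ->
  \forall x \ae mu, prep_on mu (prep_add r01 a (prep_scale r01 s b)) x =
    prep_on mu a x + s * prep_on mu b x.
Proof.
move=> amu bmu; have abmu := fm_add_dominates amu bmu.
move: (pow_incl_trans r01 (prep_fun a) (@fm_add_dominatesl _ _ _ _ (prep_mu b)) abmu).
move: (pow_incl_trans r01 (prep_fun b) (@fm_add_dominatesr _ _ _ (prep_mu a) _) abmu).
apply: filterS2 => x bE aE.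
rewrite /prep_on -aE -bE /pow_incl /= /prep_on /pow_incl /=.
rewrite -[(_ + _) x]/(_ + _) -[(s *: _) x]/(s * _); ring.
Qed.

(** The norm of the space of powers is computed in any single measure that
    dominates the elements involved. *)
Lemma norm_pow_diff_quot mu a b c (s : R) :
    prep_mu a `<< mu -> prep_mu b `<< mu -> prep_mu c `<< mu ->
  (`|s *: (pow_elt r01 b - pow_elt r01 a) - pow_elt r01 c|%:E =
   'N[mu]_(r^-1)%:E[EFin \o (fun x =>
      s * (prep_on mu b x - prep_on mu a x) - prep_on mu c x)%R])%E.
Proof.
move=> amu bmu cmu.
have -> : s *: (pow_elt r01 b - pow_elt r01 a) - pow_elt r01 c =
    pow_elt r01 (prep_add r01 (prep_add r01 (prep_scale r01 (-1) c)
      (prep_scale r01 s b)) (prep_scale r01 (- s) a)).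
  rewrite -pow_elt_lin -pow_elt_lin -pow_scale_elt.
  rewrite -[pow_scale _ _]/(-1 *: pow_elt r01 c) scaleN1r scaleNr scalerBr.
  by rewrite [LHS]addrAC; congr (_ + _); exact: addrC.
rewrite -[`|_|]/(pow_norm _) pow_norm_elt.
have cmu' : prep_mu (prep_scale r01 (-1) c) `<< mu by [].
have cbmu : prep_mu (prep_add r01 (prep_scale r01 (-1) c) (prep_scale r01 s b)) `<< mu.
  exact: fm_add_dominates.
have m1 := prep_on_measurable amu.
have m2 := prep_on_measurable bmu.
have m3 := prep_on_measurable cmu.
rewrite -(@prep_norm_on _ _ _ _ r01 mu); last exact: fm_add_dominates.
apply: Lnorm_ae_eq.
- by apply: prep_on_measurable; exact: fm_add_dominates.
- apply: measurable_funB => //; apply: measurable_funM => //; exact: measurable_funB.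
- move: (prep_on_lin (- s) cbmu amu) (prep_on_lin s cmu' bmu).
  apply: filterS2 => x -> ->.
  have -> : prep_on mu (prep_scale r01 (-1) c) x = - prep_on mu c x.
    by rewrite /prep_on /pow_incl /= -[(_ *: _) x]/(-1 * _) mulN1r mulNr.
  ring.
Qed.

(** Localized form of the triangle inequality: cutting off a difference quotient
    by chi leaves the cut off derivative, plus the error of the whole quotient.
    The inclusion into L^(1/r)(mu) commutes with the multiplication by chi, so
    that the last term is a norm in the measure of the representative c. *)
Lemma Lnorm_cutoff_le mu a b c (s : R) (chi : T -> R) :
    prep_mu a `<< mu -> prep_mu b `<< mu -> prep_mu c `<< mu ->
    measurable_fun setT chi -> (forall x, 0 <= chi x <= 1) ->
  ('N[mu]_(r^-1)%:E[EFin \o (fun x =>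
      chi x * (s * (prep_on mu b x - prep_on mu a x)))%R] <=
   `|s *: (pow_elt r01 b - pow_elt r01 a) - pow_elt r01 c|%:E +
   'N[prep_mu c]_(r^-1)%:E[EFin \o (fun x => chi x * prep_fun c x)%R])%E.
Proof.
move=> amu bmu cmu mchi chi01.
have m1 := prep_on_measurable amu.
have m2 := prep_on_measurable bmu.
have m3 := prep_on_measurable cmu.
rewrite (norm_pow_diff_quot s amu bmu cmu).
pose h x := s * (prep_on mu b x - prep_on mu a x) - prep_on mu c x.
have mh : measurable_fun setT h.
  apply: measurable_funB => //; apply: measurable_funM => //; exact: measurable_funB.
have mfc : measurable_fun setT (fun x => chi x * prep_fun c x).
  by apply: measurable_funM => //; exact: prep_fun_measurable.
have r1 : 0 < r^-1 by rewrite invr_gt0; case/andP: r01.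
rewrite -(Lnorm_pow_incl r01 cmu mfc).
pose f1 x := chi x * h x.
pose f2 := pow_incl r (prep_mu c) mu (fun x => chi x * prep_fun c x).
have mf1 : measurable_fun setT f1 by exact: measurable_funM.
have mf2 : measurable_fun setT f2 by exact: pow_incl_measurable.
apply: (@le_trans _ _ ('N[mu]_(r^-1)%:E[EFin \o (f1 \+ f2)%R])%E).
  apply: le_Lnorm => //.
  - by apply: measurable_funM => //; apply: measurable_funM => //; exact: measurable_funB.
  - exact: measurable_funD.
  - move=> x; rewrite le_eqVlt; apply/orP; left; apply/eqP; congr `|_|.
    rewrite /= /f1 /f2 /h /prep_on /pow_incl; ring.
apply: le_trans (eminkowski _ mf1 mf2 (pow_index_ge1 r01)) _.
apply: leeD => //; apply: le_Lnorm => // x.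
have /andP[c0 c1] := chi01 x.
by rewrite /f1 normrM ler_piMl// ger0_norm.
Qed.

End pow_space_norm.

(** * Truncation *)

Lemma near_le_cvge0 (R : realType) (F : nat -> \bar R) (e : R) :
  (F n @[n --> \oo] --> 0)%E -> 0 < e -> \forall n \near \oo, (F n <= e%:E)%E.
Proof.
move=> /fine_cvgP[Ffin F0] e0.
apply: filterS2 Ffin (cvgr_lt _ F0 _ e0) => n Fn Fe.
by rewrite -(fineK Fn) lee_fin ltW.
Qed.

Section truncation.
Context {d : measure_display} {T : measurableType d} {R : realType}.
Implicit Types mu : {finite_measure set T -> \bar R}.

Definition tail_indic (f : T -> R) (n : nat) : T -> R := \1_[set x | n%:R < `|f x|].

Lemma tail_indic_measurable f n : measurable_fun setT f ->
  measurable_fun setT (tail_indic f n).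
Proof.
move=> mf; apply: measurable_indic.
rewrite (_ : [set x | _] = (Num.norm \o f) @^-1` `]n%:R, +oo[).
  rewrite -[X in measurable X]setTI.
  have : measurable_fun setT (Num.norm \o f) by exact: measurableT_comp.
  exact.
by apply/seteqP; split=> x; rewrite /= in_itv/= andbT.
Qed.

Lemma tail_indic01 f n x : (tail_indic f n x == 0) || (tail_indic f n x == 1).
Proof. by rewrite /tail_indic indicE; case: (_ \in _); rewrite eqxx ?orbT. Qed.

Lemma tail_indic_ge0 f n x : 0 <= tail_indic f n x.
Proof. by case/orP: (tail_indic01 f n x) => /eqP ->. Qed.

Lemma tail_indic_le1 f n x : tail_indic f n x <= 1.
Proof. by case/orP: (tail_indic01 f n x) => /eqP ->. Qed.

Lemma tail_indicC_le f n x : (1 - tail_indic f n x) * `|f x| <= n%:R.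
Proof.
rewrite /tail_indic indicE; case: (boolP (x \in _)) => [_|].
  by rewrite subrr mul0r.
by rewrite notin_setE/= subr0 mul1r => /negP; rewrite -leNgt.
Qed.

Lemma tail_indic_near0 f x : \forall n \near \oo, tail_indic f n x = 0.
Proof.
near=> n; rewrite /tail_indic indicE memNset//=.
apply/negP; rewrite -leNgt; near: n; exact: nbhs_infty_ger.
Unshelve. all: by end_near. Qed.

Lemma tail_integral_cvg0 mu (f g : T -> R) : measurable_fun setT f ->
    mu.-integrable setT (EFin \o g) ->
  (\int[mu]_x (tail_indic f n x * `|g x|)%:E @[n --> \oo] --> 0)%E.
Proof.
move=> mf ig.
have mg : measurable_fun setT g by apply/measurable_EFinP; exact: measurable_int ig.
pose F n x := (tail_indic f n x * `|g x|)%:E : \bar R.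
have mF n : measurable_fun setT (F n).
  apply/measurable_EFinP; apply: measurable_funM; first exact: tail_indic_measurable.
  exact: measurableT_comp.
have := @dominated_convergence _ _ _ mu setT measurableT F (cst 0%E)
  (fun x => `|g x|%:E) mF (measurable_cst _).
rewrite integral0 => H; suff [] : [/\ mu.-integrable setT (cst 0%E : T -> \bar R),
    ([sequence (\int[mu]_x `|F n x - cst 0%E x|)%E]_n @ \oo --> 0%E) &
    ([sequence (\int[mu]_x F n x)%E]_n @ \oo --> 0%E)] by [].
apply: H.
- apply: aeW => x _; apply: cvg_near_cst.
  by apply: filterS (tail_indic_near0 f x) => n h; rewrite /F h mul0r.
- exact: integrable_abse ig.
- apply: aeW => x n _; rewrite /F /= lee_fin normrM normr_id.
  by rewrite ler_piMl// ger0_norm ?tail_indic_ge0// tail_indic_le1.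
Qed.

(** Dominated convergence is applied in the measure of the representative c.  When c
    represents the derivative of the powers, this measure is independent of the
    increment of the parameter, and so is the bound. *)
Lemma prep_tail_near_le (r : R) (r01 : 0 < r <= 1) (f : T -> R)
    (c : pow_rep T r) (e : R) : measurable_fun setT f -> 0 < e ->
  \forall n \near \oo,
    ('N[prep_mu c]_(r^-1)%:E[EFin \o (fun x => tail_indic f n x * prep_fun c x)%R]
     <= e%:E)%E.
Proof.
move=> mf e0.
have r0 : 0 < r by case/andP: r01.
have r1 : 0 < r^-1 by rewrite invr_gt0; case/andP: r01.
have mc := prep_fun_measurable c.
have ic : (prep_mu c).-integrable setT (EFin \o (fun x => `|prep_fun c x| `^ r^-1)).
  apply/integrableP; split.
    by apply/measurable_EFinP; apply: (measurableT_comp (measurable_powR _)); exact: measurableT_comp.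
  under eq_integral => x _ do rewrite /= ger0_norm ?powR_ge0//.
  have := prep_norm_fin c; rewrite /prep_norm => /fin_numPlt /andP[_].
  move=> /poweR_lty => /(_ r^-1); rewrite powR_Lnorm ?gt_eqF//.
have := near_le_cvge0 (tail_integral_cvg0 mf ic) (powR_gt0 r^-1 e0).
apply: filterS => n Fn.
rewrite -[e](powRr1 (ltW e0)) -[1](mulVf (lt0r_neq0 r0)) powRrM -poweR_EFin unlock invrK.
apply: gt0_ler_poweR.
- exact: ltW.
- by rewrite in_itv/= leey andbT; apply: integral_ge0 => x _; rewrite lee_fin powR_ge0.
- by rewrite in_itv/= leey andbT lee_fin powR_ge0.
apply: le_trans Fn; rewrite le_eqVlt; apply/orP; left; apply/eqP.
apply: eq_integral => x _ /=; congr EFin.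
rewrite normrM; case/orP: (tail_indic01 f n x) => /eqP ->.
  by rewrite normr0 !mul0r powR0// gt_eqF.
by rewrite normr1 !mul1r (ger0_norm (powR_ge0 `|prep_fun c x| _)).
Qed.

End truncation.

(** * Densities of signed measures *)

Section charge_density.
Context {d : measure_display} {T : measurableType d} {R : realType}.
Implicit Types (mu q : {finite_measure set T -> \bar R}) (Q : signed_measure T R).
Local Open Scope charge_scope.

Lemma sm_of_measureE q A : measurable A -> sm_of_measure q A = q A.
Proof. exact: sm_of_chargeE. Qed.

(** Finite version of the Radon-Nikodym derivative of a signed measure; the
    logarithmic derivative is an instance of it. *)
Definition charge_density Q q (x : T) : R := fine (('d Q '/d q) x).

Lemma charge_densityE Q q : Q `<< q -> EFin \o charge_density Q q = 'd Q '/d q.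
Proof.
by move=> Qq; apply/funext => x /=; rewrite fineK// Radon_Nikodym_fin_num.
Qed.

Lemma charge_density_integrable Q q : Q `<< q ->
  q.-integrable setT (EFin \o charge_density Q q).
Proof. by move=> Qq; rewrite charge_densityE//; exact: Radon_Nikodym_integrable. Qed.

Lemma charge_density_measurable Q q : Q `<< q ->
  measurable_fun setT (charge_density Q q).
Proof.
by move=> Qq; apply/measurable_EFinP; exact: measurable_int (charge_density_integrable Qq).
Qed.

Lemma charge_density_integral Q q A : Q `<< q -> measurable A ->
  (Q A = \int[q]_(x in A) (charge_density Q q x)%:E)%E.
Proof.
by move=> Qq mA; rewrite (Radon_Nikodym_integral Qq mA) -(charge_densityE Qq).
Qed.

Lemma Lfun_integrable1 q (k : R) (f : T -> R) :
  1 <= k -> f \in Lfun q k%:E -> q.-integrable setT (EFin \o f).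
Proof.
move=> k1 h; apply/Lfun1_integrable.
have k1e : (1 <= k%:E)%E by rewrite lee_fin.
by apply: (Lfun_subset (lexx 1%E) k1e _ k1e) h; exact: fin_num_measure.
Qed.

Lemma exists_dominating3 q0 q1 q2 : exists mu,
  [/\ q0 `<< mu, q1 `<< mu & q2 `<< mu].
Proof.
exists (fm_add (fm_add q0 q1) q2); split; last exact: fm_add_dominatesr.
- apply: (@null_dominates_trans _ _ _ _ (fm_add q0 q1));
    exact: fm_add_dominatesl.
- apply: (@null_dominates_trans _ _ _ _ (fm_add q0 q1)).
    exact: fm_add_dominatesr.
  exact: fm_add_dominatesl.
Qed.

End charge_density.

(** * Difference quotients between two measures *)

Section two_measures.
Context {d : measure_display} {T : measurableType d} {R : realType}.
Implicit Types q : {finite_measure set T -> \bar R}.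
Local Open Scope charge_scope.
Variables (q0 q1 : {finite_measure set T -> \bar R}) (Q : signed_measure T R) (s : R).
Hypothesis Qq0 : Q `<< q0.
Let nu : signed_measure T R := s *: (sm_of_measure q1 - sm_of_measure q0) - Q.

Variable mu : {finite_measure set T -> \bar R}.
Hypotheses (q0mu : q0 `<< mu) (q1mu : q1 `<< mu).

(** In the application, s is the inverse of the increment of the parameter, while
    Q and the element represented by c are the derivatives at the point of q0 of
    the measures and of their k'-th roots.  Thus nu and dist measure the errors of
    the two difference quotients; this is the density of nu with respect to mu. *)
Definition diff_quot_density (x : T) : R :=
  s * (rn_density q1 mu x - rn_density q0 mu x) -
  charge_density Q q0 x * rn_density q0 mu x.
Local Notation D := diff_quot_density.

Lemma integrable_diff_quot_density (f : T -> R) :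
  q0.-integrable setT (EFin \o f) -> q1.-integrable setT (EFin \o f) ->
  q0.-integrable setT (EFin \o (fun x => f x * charge_density Q q0 x)) ->
  mu.-integrable setT (EFin \o (fun x => f x * D x)).
Proof.
move=> i0 i1 iQ.
pose g x := s * (f x * rn_density q1 mu x - f x * rn_density q0 mu x) -
  f x * charge_density Q q0 x * rn_density q0 mu x.
rewrite (_ : (fun x => f x * D x) = g); last by apply/funext => x; rewrite /g /D; ring.
have H := integrableB measurableT (integrableZl measurableT s (integrableB measurableT
  (integrable_rn_density q1mu i1) (integrable_rn_density q0mu i0)))
  (integrable_rn_density q0mu iQ).
exact: eq_integrable H.
Qed.

Lemma Rintegral_diff_quot_density (f : T -> R) A : measurable A ->
  q0.-integrable setT (EFin \o f) -> q1.-integrable setT (EFin \o f) ->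
  q0.-integrable setT (EFin \o (fun x => f x * charge_density Q q0 x)) ->
  \int[mu]_(x in A) (f x * D x) =
  s * (\int[q1]_(x in A) f x - \int[q0]_(x in A) f x) -
  \int[q0]_(x in A) (f x * charge_density Q q0 x).
Proof.
move=> mA i0 i1 iQ.
pose g x := s * (f x * rn_density q1 mu x - f x * rn_density q0 mu x) -
  f x * charge_density Q q0 x * rn_density q0 mu x.
rewrite (_ : (fun x => f x * D x) = g); last by apply/funext => x; rewrite /g /D; ring.
have j1 := integrable_rn_density q1mu i1.
have j0 := integrable_rn_density q0mu i0.
have jQ := integrable_rn_density q0mu iQ.
have S (h : T -> \bar R) : mu.-integrable setT h -> mu.-integrable A h.
  by move=> ih; apply: integrableS ih.
rewrite /g RintegralB//; last 2 first.
- exact: S (integrableZl measurableT s (integrableB measurableT j1 j0)).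
- exact: S jQ.
rewrite RintegralZl//; last exact: S (integrableB measurableT j1 j0).
rewrite RintegralB//; [|exact: S j1|exact: S j0].
rewrite /Rintegral.
rewrite (integral_rn_density q1mu mA i1) (integral_rn_density q0mu mA i0).
by rewrite (integral_rn_density q0mu mA iQ).
Qed.

Lemma integral_norm_diff_quot_density_le :
  (\int[mu]_x `|D x|%:E <= (`|nu|)%:E)%E.
Proof.
have i1 q : q.-integrable setT (EFin \o cst (1 : R)).
  exact: finite_measure_integrable_cst.
have iQ : q0.-integrable setT (EFin \o (fun x => cst 1 x * charge_density Q q0 x)).
  by apply: eq_integrable (charge_density_integrable Qq0) => // x _; rewrite /= mul1r.
have ED : (fun x => cst 1 x * D x) = D by apply/funext => x; rewrite /= mul1r.
apply: integral_normr_le_tv.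
  by have := integrable_diff_quot_density (i1 q0) (i1 q1) iQ; rewrite ED.
move=> A mA.
have := Rintegral_diff_quot_density mA (i1 q0) (i1 q1) iQ; rewrite ED => DE.
rewrite -[RHS]fineK; last first.
  apply: integrable_fin_num => //; apply: integrableS measurableT _ _ _ => //.
  by have := integrable_diff_quot_density (i1 q0) (i1 q1) iQ; rewrite ED.
rewrite -[X in _ = X%:E]/(\int[mu]_(x in A) D x) DE.
rewrite /nu -(scaleN1r Q) -(scaleN1r (sm_of_measure q0)).
rewrite !(sm_addE, sm_scaleE)//.
rewrite !sm_of_measureE//.
have c1 q : \int[q]_(x in A) cst 1 x = fine (q A).
  by rewrite Rintegral_cst// mul1r.
have -> : \int[q0]_(x in A) (cst 1 x * charge_density Q q0 x) = fine (Q A).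
  rewrite (charge_density_integral Qq0 mA); congr fine.
  by apply: eq_integral => x _; rewrite /= mul1r.
rewrite !c1.
have F (m : {finite_measure set T -> \bar R}) : m A = (fine (m A))%:E.
  by rewrite fineK// fin_num_measure.
have FQ : Q A = (fine (Q A))%:E by rewrite fineK// fin_num_measure.
rewrite (F q1) (F q0) FQ /= -!EFinM -!EFinD; congr EFin; ring.
Qed.

Variables (k k' C : R) (c : pow_rep T k'^-1) (phi : T -> R).
Hypotheses (k1 : 1 < k) (k'1 : 1 < k') (dual : k^-1 + k'^-1 = 1).
Hypothesis cmu : prep_mu c `<< mu.
Hypotheses (phi0 : phi \in Lfun q0 k%:E) (phi1 : phi \in Lfun q1 k%:E).
Hypotheses (C0 : ('N[q0]_k%:E[EFin \o phi] <= C%:E)%E)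
           (C1 : ('N[q1]_k%:E[EFin \o phi] <= C%:E)%E).
Let r01 := invr_gt0_le1 (ltW k'1).
Let P q := pow_measure r01 q.
Let dist := `|s *: (P q1 - P q0) - pow_elt r01 c|.

Let mphi : measurable_fun setT phi.
Proof. by have /andP[+ _] := phi0; rewrite inE. Qed.

(** On a set that need not avoid the large values of phi, the difference quotient
    of the measures is controlled by that of their powers: this is where the
    differentiability of the k'-th root is used. *)
Lemma integral_cutoff_le (chi : T -> R) :
    measurable_fun setT chi -> (forall x, 0 <= chi x <= 1) ->
  (\int[mu]_x (chi x * `|phi x * (s * (rn_density q1 mu x - rn_density q0 mu x))|)%:E
   <= (k' * (C + C))%:E * (dist%:E +
     'N[prep_mu c]_k'%:E[EFin \o (fun x => chi x * prep_fun c x)%R]))%E.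
Proof.
move=> mchi chi01.
have C_ge0 : 0 <= C by rewrite -lee_fin (le_trans _ C0)// Lnorm_ge0.
(* The scalar s is moved into the weight of the Hoelder estimate. *)
pose chis x := `|s| * chi x.
have mchis : measurable_fun setT chis by exact: measurable_funM.
have chis0 x : 0 <= chis x by rewrite mulr_ge0//; case/andP: (chi01 x).
have := integral_density_sub_le k1 k'1 dual q0mu q1mu mphi mchis chis0 C0 C1.
rewrite (_ : (\int[mu]_x _)%E = (\int[mu]_x (chi x * `|phi x *
    (s * (rn_density q1 mu x - rn_density q0 mu x))|)%:E)%E); last first.
  by apply: eq_integral => x _; congr EFin; rewrite /chis !normrM; ring.
move=> /le_trans; apply.
apply: lee_wpmul2l; first by rewrite lee_fin mulr_ge0 ?addr_ge0// ltW// (lt_trans ltr01).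
pose a := PowRep (Lfun_cst q0 1 k'^-1^-1).
pose b := PowRep (Lfun_cst q1 1 k'^-1^-1).
have := @Lnorm_cutoff_le _ _ _ _ r01 mu a b c s chi q0mu q1mu cmu mchi chi01.
rewrite invrK; apply: le_trans.
have mu01 : measurable_fun setT (fun x =>
    rn_density q1 mu x `^ k'^-1 - rn_density q0 mu x `^ k'^-1).
  by apply: measurable_funB; exact: rn_density_powR_measurable.
apply: le_Lnorm; first exact: lt_trans k'1.
- exact: measurable_funM.
- apply: measurable_funM => //; apply: measurable_funM => //.
  by apply: measurable_funB; exact: prep_on_measurable.
- move=> x; rewrite /chis /prep_on /pow_incl /= !mul1r !normrM !normr_id.
  by rewrite le_eqVlt; apply/orP; left; apply/eqP; ring.
Qed.

Let mD : measurable_fun setT D.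
Proof.
apply: measurable_funB; apply: measurable_funM => //; try exact: rn_density_measurable.
  by apply: measurable_funB; exact: rn_density_measurable.
exact: charge_density_measurable.
Qed.

Let msub : measurable_fun setT (fun x => s * (rn_density q1 mu x - rn_density q0 mu x)).
Proof.
apply: measurable_funM => //; by apply: measurable_funB; exact: rn_density_measurable.
Qed.

Let ml : measurable_fun setT (fun x => phi x * charge_density Q q0 x).
Proof. by apply: measurable_funM => //; exact: charge_density_measurable. Qed.

Lemma integral_rn_density_norm (chi : T -> R) :
    measurable_fun setT chi -> (forall x, 0 <= chi x) ->
  (\int[mu]_x (chi x * `|phi x * charge_density Q q0 x * rn_density q0 mu x|)%:E =
   \int[q0]_x (chi x * `|phi x * charge_density Q q0 x|)%:E)%E.
Proof.
move=> mchi chi0; rewrite -(ge0_integral_rn_density q0mu); last 2 first.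
- by apply/measurable_EFinP; apply: measurable_funM => //; exact: measurableT_comp.
- by move=> x; rewrite lee_fin mulr_ge0.
apply: ae_eq_integral => //.
- apply/measurable_EFinP; apply: measurable_funM => //; apply: measurableT_comp => //.
  by apply: measurable_funM => //; exact: rn_density_measurable.
- apply/measurable_EFinP; apply: measurable_funM; last exact: rn_density_measurable.
  by apply: measurable_funM => //; exact: measurableT_comp.
- apply: filterS (rn_density_ge0 q0mu) => x r0 _.
  by rewrite normrM (ger0_norm r0) -EFinM mulrA.
Qed.

Let mtail n := tail_indic_measurable n mphi.

(** Here phi * l is compared with the difference quotient on the set where
    |phi| <= n, at the cost of n times the total variation of nu.  As the last
    term does not depend on n, letting first s^-1 tend to 0 and then n grow
    gives the integrability of phi * l. *)
Lemma integral_truncated_le n :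
  (\int[q0]_x ((1 - tail_indic phi n x) * `|phi x * charge_density Q q0 x|)%:E <=
   (n%:R * `|nu|)%:E + (k' * (C + C))%:E * (dist%:E +
     'N[prep_mu c]_k'%:E[EFin \o prep_fun c]))%E.
Proof.
have mt : measurable_fun setT (fun x => 1 - tail_indic phi n x).
  by apply: measurable_funB => //; exact: mtail.
rewrite -integral_rn_density_norm//; last first.
  by move=> x; rewrite subr_ge0 tail_indic_le1.
pose f1 x := (n%:R%:E * `|D x|%:E)%E.
pose f2 x := (cst 1 x * `|phi x * (s * (rn_density q1 mu x - rn_density q0 mu x))|)%:E.
have f1_ge0 x : [set: T] x -> (0 <= f1 x)%E by move=> _; rewrite /f1 -EFinM lee_fin mulr_ge0.
have f2_ge0 x : [set: T] x -> (0 <= f2 x)%E by move=> _; rewrite /f2 lee_fin mulr_ge0.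
have mf1 : measurable_fun setT f1.
  by apply/measurable_EFinP; apply: measurable_funM => //; exact: measurableT_comp.
have mf2 : measurable_fun setT f2.
  apply/measurable_EFinP; apply: measurable_funM => //; apply: measurableT_comp => //.
  exact: measurable_funM.
apply: (@le_trans _ _ (\int[mu]_x (f1 x + f2 x))%E).
  apply: ge0_le_integral => //.
  - by move=> x _; rewrite lee_fin mulr_ge0// subr_ge0 tail_indic_le1.
  - apply/measurable_EFinP; apply: measurable_funM => //; apply: measurableT_comp => //.
    by apply: measurable_funM => //; exact: rn_density_measurable.
  - exact: emeasurable_funD.
  - move=> x _; rewrite /f1 /f2 -EFinM -EFinD lee_fin mul1r.
    set t := tail_indic phi n x.
    have t0 : 0 <= t := tail_indic_ge0 _ _ _.
    have t1 : 0 <= 1 - t by rewrite subr_ge0 tail_indic_le1.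
    have tn : (1 - t) * `|phi x| <= n%:R := tail_indicC_le _ _ _.
    have -> : phi x * charge_density Q q0 x * rn_density q0 mu x =
      phi x * (s * (rn_density q1 mu x - rn_density q0 mu x)) - phi x * D x.
      by rewrite /D; ring.
    set y := phi x * (s * _).
    apply: (@le_trans _ _ ((1 - t) * (`|y| + `|phi x * D x|))).
      by apply: ler_wpM2l => //; exact: ler_normB.
    rewrite mulrDr addrC; apply: lerD.
      by rewrite normrM mulrA ler_wpM2r.
    by rewrite ler_piMl// gerBl.
rewrite ge0_integralD// /f1.
rewrite ge0_integralZl//; last by apply/measurable_EFinP; exact: measurableT_comp.
apply: leeD.
  by rewrite EFinM; apply: lee_wpmul2l => //; exact: integral_norm_diff_quot_density_le.
have := @integral_cutoff_le (cst 1) (measurable_cst _).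
rewrite (_ : (fun x => cst 1 x * prep_fun c x) = prep_fun c); last first.
  by apply/funext => x; rewrite /= mul1r.
by apply => x /=; rewrite ler01 lexx.
Qed.

(** The error of the difference quotient of the integral of phi splits into the
    part where |phi| <= n, bounded by n times the total variation of nu, and the
    two tails: that of the quotient and that of its expected limit. *)
Lemma diff_quot_Rintegral_le n :
    q0.-integrable setT (EFin \o (fun x => phi x * charge_density Q q0 x)) ->
  (`|s * (\int[q1]_x phi x - \int[q0]_x phi x) -
      \int[q0]_x (phi x * charge_density Q q0 x)|%:E <=
   (n%:R * `|nu|)%:E + (k' * (C + C))%:E * (dist%:E +
     'N[prep_mu c]_k'%:E[EFin \o (fun x => tail_indic phi n x * prep_fun c x)%R]) +
   \int[q0]_x (tail_indic phi n x * `|phi x * charge_density Q q0 x|)%:E)%E.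
Proof.
move=> iQ.
have i0 := Lfun_integrable1 (ltW k1) phi0.
have i1 := Lfun_integrable1 (ltW k1) phi1.
rewrite -(Rintegral_diff_quot_density measurableT i0 i1 iQ).
have iD := integrable_diff_quot_density i0 i1 iQ.
rewrite -(integral_rn_density_norm (mtail n) (tail_indic_ge0 phi n)).
apply: (@le_trans _ _ (\int[mu]_x `|phi x * D x|%:E)%E).
  rewrite EFin_normr_Rintegral//.
  exact: (le_abse_integral mu measurableT (measurable_int _ iD)).
pose f1 x := (n%:R%:E * `|D x|%:E)%E.
pose f2 x := (tail_indic phi n x *
  `|phi x * (s * (rn_density q1 mu x - rn_density q0 mu x))|)%:E.
pose f3 x := (tail_indic phi n x *
  `|phi x * charge_density Q q0 x * rn_density q0 mu x|)%:E.
have f1_ge0 x : [set: T] x -> (0 <= f1 x)%E by move=> _; rewrite /f1 -EFinM lee_fin mulr_ge0.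
have f2_ge0 x : [set: T] x -> (0 <= f2 x)%E.
  by move=> _; rewrite lee_fin mulr_ge0// tail_indic_ge0.
have f3_ge0 x : [set: T] x -> (0 <= f3 x)%E.
  by move=> _; rewrite lee_fin mulr_ge0// tail_indic_ge0.
have mf1 : measurable_fun setT f1.
  by apply/measurable_EFinP; apply: measurable_funM => //; exact: measurableT_comp.
have mf2 : measurable_fun setT f2.
  apply/measurable_EFinP; apply: measurable_funM => //; apply: measurableT_comp => //.
  exact: measurable_funM.
have mf3 : measurable_fun setT f3.
  apply/measurable_EFinP; apply: measurable_funM => //; apply: measurableT_comp => //.
  by apply: measurable_funM => //; exact: rn_density_measurable.
have mf12 : measurable_fun setT (fun x => f1 x + f2 x)%E by exact: emeasurable_funD.
have f12_ge0 x : [set: T] x -> (0 <= f1 x + f2 x)%E.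
  by move=> Tx; rewrite adde_ge0 ?f1_ge0 ?f2_ge0.
apply: (@le_trans _ _ (\int[mu]_x (f1 x + f2 x + f3 x))%E).
  apply: ge0_le_integral => //.
  - by have /integrableP[+ _] := integrable_abse iD.
  - exact: emeasurable_funD.
  - move=> x _; rewrite /f1 /f2 /f3 -EFinM -!EFinD lee_fin.
    set t := tail_indic phi n x.
    have t0 : 0 <= t := tail_indic_ge0 _ _ _.
    have tn : (1 - t) * `|phi x| <= n%:R := tail_indicC_le _ _ _.
    have -> : `|phi x * D x| = (1 - t) * `|phi x * D x| + t * `|phi x * D x| by ring.
    rewrite -addrA; apply: lerD; first by rewrite normrM mulrA ler_wpM2r.
    rewrite -mulrDr; apply: ler_wpM2l => //.
    have -> : phi x * D x = phi x * (s * (rn_density q1 mu x - rn_density q0 mu x)) -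
        phi x * charge_density Q q0 x * rn_density q0 mu x by rewrite /D; ring.
    exact: ler_normB.
rewrite ge0_integralD//; apply: leeD => //.
rewrite ge0_integralD// /f1.
rewrite ge0_integralZl//; last by apply/measurable_EFinP; exact: measurableT_comp.
apply: leeD.
  by rewrite EFinM; apply: lee_wpmul2l => //; exact: integral_norm_diff_quot_density_le.
apply: integral_cutoff_le; first exact: mtail.
by move=> x; rewrite tail_indic_ge0 tail_indic_le1.
Qed.

End two_measures.

(** * Derivatives along lines *)

Section diff_quot.
Context {R : realType} {V W : normedModType R}.

Lemma diff_quot_near_le (f : V -> W) (a v : V) (e : R) :
    differentiable f a -> 0 < e ->
  \forall h \near (0 : R)^', `|h^-1 *: (f (h *: v + a) - f a) - 'd f a v| <= e.
Proof.
move=> df e0.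
have : h^-1 *: ((f \o shift a) (h *: v) - f a) @[h --> (0 : R)^'] --> 'd f a v.
  by rewrite -deriveE//; exact: diff_derivable.
move=> /cvgrPdist_le /(_ e e0).
by apply: filterS => h; rewrite distrC.
Qed.

Lemma line_cvg (a v : V) : h *: v + a @[h --> (0 : R)^'] --> a.
Proof.
have : h *: v + a @[h --> (0 : R)] --> 0 *: v + a.
  apply: cvgD; last exact: cvg_cst.
  by apply: cvgZr_tmp; exact: cvg_id.
rewrite scale0r add0r => H.
by apply: cvg_trans H; apply: cvg_app; exact: cvg_within.
Qed.

End diff_quot.

Section local.
Context {d : measure_display} {T : measurableType d} {R : realType}.
Context {V : normedModType R} (q : V -> {finite_measure set T -> \bar R}) (a : V).
Local Open Scope charge_scope.

Let sq y := sm_of_measure (q y).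
Hypothesis dsq : differentiable sq a.

(** If q(a)(A) = 0, then the function h |-> q(a + h v)(A) is nonnegative and
    vanishes at 0: its difference quotients are nonpositive on the left and
    nonnegative on the right, so that its derivative is 0. *)
Lemma diff_measure_dominated v : ('d sq a v : signed_measure T R) `<< q a.
Proof.
apply/null_content_dominatesP => A mA qA0.
set Q : signed_measure T R := 'd sq a v.
have QA : Q A \is a fin_num by rewrite fin_num_measure.
pose r (h : R) := h^-1 * fine (q (h *: v + a) A).
have r_cvg : r h @[h --> (0 : R)^'] --> fine (Q A).
  apply/cvgrPdist_le => e e0.
  apply: filterS (diff_quot_near_le v dsq e0) => h; apply: le_trans.
  set nu : signed_measure T R := _ - _.
  have := le_tv_norm nu mA measurable0 (setI0 A).
  rewrite charge0 abse0 adde0 -[tv_norm nu]/(`|nu|).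
  have -> : nu A = (r h - fine (Q A))%:E.
    rewrite /nu -(scaleN1r Q) -(scaleN1r (sq a)) !(sm_addE, sm_scaleE)//.
    rewrite /sq !sm_of_measureE//.
    rewrite qA0 mule0 adde0 /r EFinB EFinM fineK ?fin_num_measure// fineK//.
    by rewrite mulN1e.
  by rewrite /= lee_fin distrC.
rewrite -(fineK QA); congr EFin; apply/eqP; rewrite eq_le; apply/andP; split.
- apply: (cvgr_to_le (cvg_dnbhs_at_left r_cvg)).
  apply: filterS (nbhs_left_lt (0 : R)) => h h0.
  by rewrite /r mulr_le0_ge0 ?fine_ge0// invr_le0 ltW.
- apply: (cvgr_to_ge (cvg_dnbhs_at_right r_cvg)).
  apply: filterS (nbhs_right_gt (0 : R)) => h h0.
  by rewrite /r mulr_ge0 ?fine_ge0// invr_ge0 ltW.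
Qed.

Variables (k k' C : R) (phi : T -> R).
Hypotheses (k1 : 1 < k) (k'1 : 1 < k') (dual : k^-1 + k'^-1 = 1).
Let r01 := invr_gt0_le1 (ltW k'1).
Let pq y := pow_measure r01 (q y).
Hypothesis dpq : differentiable pq a.
Hypothesis phiL : forall y, phi \in Lfun (q y) k%:E.
Hypothesis phiC : \forall y \near a, ('N[q y]_k%:E[EFin \o phi] <= C%:E)%E.

Let K := k' * (C + C).
Let l v := charge_density ('d sq a v) (q a).

Let mphi : measurable_fun setT phi.
Proof. by have /andP[+ _] := phiL a; rewrite inE. Qed.

Let Ca : ('N[q a]_k%:E[EFin \o phi] <= C%:E)%E.
Proof. exact: nbhs_singleton phiC. Qed.

Let K0 : 0 <= K.
Proof.
have C_ge0 : 0 <= C by rewrite -lee_fin (le_trans _ Ca)// Lnorm_ge0.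
by rewrite mulr_ge0 ?addr_ge0// ltW// (lt_trans ltr01).
Qed.

Let phiC_line (v : V) : \forall h \near (0 : R)^',
  ('N[q (h *: v + a)%R]_k%:E[EFin \o phi] <= C%:E)%E.
Proof. exact: line_cvg v _ phiC. Qed.

Let mphil v : measurable_fun setT (fun x => phi x * l v x).
Proof.
by apply: measurable_funM => //; apply: charge_density_measurable; exact: diff_measure_dominated.
Qed.

(** Limit of [integral_truncated_le] as the increment h tends to 0. *)
Lemma integral_truncated_diff_le v n :
  (\int[q a]_x ((1 - tail_indic phi n x) * `|phi x * l v x|)%:E <=
   (K * `|'d pq a v|)%:E)%E.
Proof.
apply/lee_addgt0Pr => e e0.
(* The two errors enter with the factors n and K; 1 only avoids a division by 0. *)
pose e1 := e / (n%:R + K + 1).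
have den : 0 < n%:R + K + 1 by rewrite ltr_wpDl ?addr_ge0.
have e10 : 0 < e1 by rewrite divr_gt0.
have : \forall h \near (0 : R)^', (\int[q a]_x ((1 - tail_indic phi n x) *
    `|phi x * l v x|)%:E <= (K * `|'d pq a v|)%:E + e%:E)%E; last first.
  by move=> /filter_ex[].
apply: filterS3 (phiC_line v) (diff_quot_near_le v dsq e10)
  (diff_quot_near_le v dpq e10) => h Ch sh ph.
set c := repr ('d pq a v).
have cE : 'd pq a v = pow_elt r01 c by rewrite pow_eltK.
have [mu [d0 d1 dc]] := exists_dominating3 (q a) (q (h *: v + a)) (prep_mu c).
apply: le_trans (integral_truncated_le h^-1 (diff_measure_dominated v) d0 d1 k1 k'1 dual
  dc (phiL a) Ca Ch n) _.
have -> : ('N[prep_mu c]_k'%:E[EFin \o prep_fun c] = (`|'d pq a v|)%:E)%E.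
  have := pow_norm_elt r01 c; rewrite /prep_norm invrK => <-.
  by rewrite [in RHS]cE.
rewrite -cE.
apply: (@le_trans _ _ ((n%:R * e1)%:E + K%:E * (e1%:E + (`|'d pq a v|)%:E))%E).
  apply: leeD; first by rewrite lee_fin ler_wpM2l.
  by apply: lee_wpmul2l; [rewrite lee_fin|apply: leeD => //; rewrite lee_fin].
rewrite -(EFinD e1) -EFinM -!EFinD lee_fin.
have H3 : n%:R * e1 + K * e1 <= e.
  rewrite -mulrDl /e1 mulrA ler_pdivrMr// mulrC ler_wpM2l ?(ltW e0)//.
  by rewrite lerDl.
lra.
Qed.

(** The bound is linear in the derivative of the k'-th root, hence in v: it gives
    both the integrability and the continuity of the Gateaux derivative. *)
Lemma integral_diff_le v :
  (\int[q a]_x `|phi x * l v x|%:E <= (K * `|'d pq a v|)%:E)%E.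
Proof.
pose g n x := ((1 - tail_indic phi n x) * `|phi x * l v x|)%:E.
have mg n : measurable_fun setT (g n).
  apply/measurable_EFinP; apply: measurable_funM; last exact: measurableT_comp.
  by apply: measurable_funB => //; exact: tail_indic_measurable.
have g0 n x : setT x -> (0 <= g n x)%E.
  by move=> _; rewrite lee_fin mulr_ge0// subr_ge0 tail_indic_le1.
have gnd x : setT x -> {homo g^~ x : n m / (n <= m)%N >-> (n <= m)%E}.
  move=> _ n m nm; rewrite lee_fin ler_wpM2r// lerB// /tail_indic !indicE.
  rewrite ler_nat; case: (boolP (x \in [set x0 | m%:R < `|phi x0|])) => //.
  rewrite !inE/= => mx; rewrite mem_set//=.
  by apply: le_lt_trans mx; rewrite ler_nat.
have := @cvg_monotone_convergence _ _ _ (q a) _ measurableT _ mg g0 gnd.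
have -> : (\int[q a]_x limn (g^~ x) = \int[q a]_x `|phi x * l v x|%:E)%E.
  apply: eq_integral => x _; apply/cvg_lim => //; apply: cvg_near_cst.
  by apply: filterS (tail_indic_near0 phi x) => n h; rewrite /g h subr0 mul1r.
move=> H; rewrite -(cvg_lim _ H)//; apply: lime_le; first by apply/cvg_ex; eexists; exact: H.
by apply: nearW => n; exact: integral_truncated_diff_le.
Qed.

Lemma integrable_diff v : (q a).-integrable setT (EFin \o (fun x => phi x * l v x)).
Proof.
apply/integrableP; split; first exact/measurable_EFinP.
exact: le_lt_trans (integral_diff_le v) (ltry _).
Qed.

Let L v := \int[q a]_x (phi x * l v x).

Let L_le v : `|L v| <= K * `|'d pq a v|.
Proof.
rewrite -lee_fin EFin_normr_Rintegral//; last exact: integrable_diff.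
apply: le_trans (integral_diff_le v).
exact: (le_abse_integral _ measurableT (measurable_int _ (integrable_diff v))).
Qed.

(* Densities are unique almost everywhere, so that l inherits the linearity of the
   derivative of the measures. *)
Let l_lin (b : R) v w : \forall x \ae q a, l (b *: v + w) x = b * l v x + l w x.
Proof.
have i u : (q a).-integrable setT (EFin \o l u).
  by apply: charge_density_integrable; exact: diff_measure_dominated.
have ib := integrableD measurableT (integrableZl measurableT b (i v)) (i w).
suff : ae_eq (q a) setT (EFin \o l (b *: v + w))
    ((fun x => b%:E * (EFin \o l v) x)%E \+ (EFin \o l w))%E.
  by apply: filterS => x /(_ I) /=; rewrite -EFinM -EFinD => -[].
apply: integral_ae_eq => //; first exact: measurable_int ib.
move=> A _ mA.
have iA u : (q a).-integrable A (EFin \o l u) by exact: integrableS (i u).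
rewrite integralD//; last exact: integrableZl.
rewrite integralZl// -!charge_density_integral//; try exact: diff_measure_dominated.
by rewrite linearP sm_addE// sm_scaleE.
Qed.

Let L_linear : linear L.
Proof.
move=> b v w.
have i := integrable_diff.
rewrite -[b *: L v]/(b * L v) /L -RintegralZl// -RintegralD//; last first.
  exact: (integrableZl measurableT b (i v)).
congr fine; apply: ae_eq_integral => //.
- exact/measurable_EFinP.
- by apply/measurable_EFinP; apply: measurable_funD => //; exact: measurable_funM.
- apply: filterS (l_lin b v w) => x -> _; congr EFin; ring.
Qed.

Let L_continuous : continuous L.
Proof.
move=> v; apply/cvgrPdist_le => e e0.
have Kp : 0 < K + 1 by rewrite ltr_wpDl.
have dc : continuous ('d pq a) by exact: diff_continuous dpq.
have := dc v.
move=> /cvgrPdist_le /(_ (e / (K + 1)) (divr_gt0 e0 Kp)).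
apply: filterS => w vw.
have -> : L v - L w = L (v - w).
  by have := L_linear 1 (v - w) w; rewrite !scale1r subrK => ->; rewrite addrK.
apply: le_trans (L_le _) _; rewrite linearB.
apply: (@le_trans _ _ (K * (e / (K + 1)))); first by rewrite ler_wpM2l.
by rewrite mulrCA ler_piMr ?(ltW e0)// ler_pdivrMr// mul1r lerDl.
Qed.

Let L_cvg v : h^-1 *: (\int[q (h *: v + a)]_x phi x - \int[q a]_x phi x)
  @[h --> (0 : R)^'] --> L v.
Proof.
apply/cvgrPdist_le => e e0.
have Kp : 0 < K + 1 by rewrite ltr_wpDl.
pose e1 := e / (4 * (K + 1)).
have e10 : 0 < e1 by rewrite divr_gt0// mulr_gt0.
have e40 : 0 < e / 4 by rewrite divr_gt0.
set c := repr ('d pq a v).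
have cE : 'd pq a v = pow_elt r01 c by rewrite pow_eltK.
have iv := integrable_diff v.
(* The truncation height is fixed before the increment h: the tolerance e2 for
   the total variation depends on it. *)
have [n [Nn tn]] : exists n,
   ('N[prep_mu c]_k'%:E[EFin \o (fun x => tail_indic phi n x * prep_fun c x)%R] <= e1%:E)%E /\
   (\int[q a]_x (tail_indic phi n x * `|phi x * l v x|)%:E <= (e / 4)%:E)%E.
  have := prep_tail_near_le r01 c mphi e10; rewrite invrK => Nn.
  have tn := near_le_cvge0 (tail_integral_cvg0 mphi iv) e40.
  have [n [Hn Hn']] := filter_ex (filterI Nn tn).
  by exists n.
pose e2 := e / (4 * (n%:R + 1)).
have np : 0 < n%:R + 1 :> R by rewrite ltr_wpDl.
have e20 : 0 < e2 by rewrite divr_gt0// mulr_gt0.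
apply: filterS3 (phiC_line v) (diff_quot_near_le v dsq e20)
  (diff_quot_near_le v dpq e10) => h Ch sh ph.
have [mu [d0 d1 dc]] := exists_dominating3 (q a) (q (h *: v + a)) (prep_mu c).
rewrite distrC -lee_fin.
apply: le_trans (diff_quot_Rintegral_le h^-1 (diff_measure_dominated v) d0 d1 k1 k'1 dual
  dc (phiL a) (phiL _) Ca Ch n iv) _.
rewrite -cE.
apply: (@le_trans _ _ ((n%:R * e2)%:E + K%:E * (e1%:E + e1%:E) + (e / 4)%:E)%E).
  apply: leeD => //; apply: leeD; first by rewrite lee_fin ler_wpM2l.
  by apply: lee_wpmul2l; [rewrite lee_fin|apply: leeD => //; rewrite lee_fin].
rewrite -(EFinD e1) -EFinM -!EFinD lee_fin.
have H (x : R) : 0 <= x -> x * (e / (4 * (x + 1))) <= e / 4.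
  move=> x0; have x1 : 0 < x + 1 by rewrite ltr_wpDl.
  rewrite mulrA ler_pdivrMr ?mulr_gt0// (_ : _ / 4 * _ = (x + 1) * e); last by field.
  by rewrite ler_wpM2r ?(ltW e0)// lerDl.
have H1 : n%:R * e2 <= e / 4 by exact: H.
have H2 : K * e1 <= e / 4 by exact: H.
lra.
Qed.

Lemma gateaux_derivative_integral :
  gateaux_derivative_at (fun y => \int[q y]_x phi x) a L.
Proof.
split; [exact: L_linear|exact: L_continuous|] => v.
apply: DeriveDef; first by apply/cvg_ex; exists (L v); exact: L_cvg.
by apply: cvg_lim; [exact: norm_hausdorff|exact: L_cvg].
Qed.

End local.

(** * Expectations in a parametrized measure model *)

Lemma limf_esup_lt_pinfty_near (T : topologicalType) (R : realType)
    (f : T -> \bar R) (x : T) :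
    (forall y, 0 <= f y)%E -> (limf_esup f (nbhs x) < +oo)%E ->
  exists C : R, \forall y \near x, (f y <= C%:E)%E.
Proof.
move=> f0 /ereal_inf_lt[_ [A xA <-]] supA.
have fA y : A y -> (f y <= ereal_sup (f @` A))%E.
  by move=> Ay; apply: ereal_sup_ubound; exists y.
exists (fine (ereal_sup (f @` A))); apply: filterS xA => y Ay.
rewrite fineK; first exact: fA.
by rewrite ge0_fin_numE//; apply: le_trans (fA _ Ay).
Qed.

Theorem proposition3p3 (R : realType) (d : measure_display)
  (Omega : measurableType d) (M : banachManifold R)
  (p : M -> {finite_measure set Omega -> \bar R}) (k k' : R)
  (k_gt1 : 1 < k) (k'_gt1 : 1 < k') (dual : k^-1 + k'^-1 = 1)
  (p_model : parametrized_measure_model p)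
  (p_integrable : integrable_model p (ltW k'_gt1))
  (phi : Omega -> R) (phi_regular : regular p k phi) :
  forall xi : M,
    (forall X : tangent xi,
       (p xi).-integrable [set: Omega]
         (fun x => (phi x * log_derivative p X x)%:E)) /\
    is_gateaux_derivative
      (fun xi' : M => \int[p xi']_x phi x)
      (fun X : tangent xi => \int[p xi]_x (phi x * log_derivative p X x)).
Proof.
move=> xi; have [phiL phi_limsup] := phi_regular.
have [C phiC] := limf_esup_lt_pinfty_near (fun y => Lnorm_ge0 _ _ _) (phi_limsup xi).
have logE i (hi : bm_dom i xi) (X : tangent xi) : log_derivative p X =
    charge_density ('d ((fun y => sm_of_measure (p y)) \o bm_param i) (bm_coord i xi) (X _ hi)) (p xi).
  by rewrite /log_derivative /charge_density (diff_alongE X hi p_model).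
(* In a chart at xi, the parametrization is continuous at the coordinate of xi, so
   that the local bound on the norms of phi can be pulled back. *)
have loc i (hi : bm_dom i xi) :
    [/\ differentiable ((fun y => sm_of_measure (p y)) \o bm_param i) (bm_coord i xi),
      differentiable ((fun y => pow_measure (invr_gt0_le1 (ltW k'_gt1)) (p y)) \o bm_param i)
        (bm_coord i xi) &
      \forall y \near bm_coord i xi, ('N[p (bm_param i y)]_k%:E[EFin \o phi] <= C%:E)%E].
  have Ui : (bm_coord i @` bm_dom i) (bm_coord i xi) by exists xi.
  split; [exact: (p_model i _ Ui).1|exact: (p_integrable i _ Ui).1|].
  have := @bm_param_cont _ M i xi hi; rewrite /prop_for /continuous_at bm_coordK// => cont.
  exact: cont _ phiC.
split=> [X|i hi].
  have [i hi] := bm_cover xi.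
  have [dsq dpq Ci] := loc i hi.
  have := integrable_diff dsq k_gt1 dual dpq (fun y => phiL (bm_param i y)) Ci (X _ hi).
  by rewrite (logE i hi) bm_coordK.
have [dsq dpq Ci] := loc i hi.
have := gateaux_derivative_integral dsq k_gt1 dual dpq (fun y => phiL (bm_param i y)) Ci.
rewrite bm_coordK// => G; eexists; first exact: G.
by move=> X; rewrite (logE i hi).
Qed.
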